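(* Let $k$ be a field and let $A=kQ/I$ be a special quasi-biserial $k$-algebra. Then $A$ is a quasi-biserial algebra.
   Context: Quivers are finite; paths are written from right to left; $s(\alpha),t(\alpha)$ denote source and target; modules are finitely generated. An ideal $I$ of $kQ$ is admissible if $\langle Q_1\rangle^m\subseteq I\subseteq\langle Q_1\rangle^2$ for some $m\ge2$, where $Q_1$ is the set of arrows. In a quiver with at most two arrows starting and at most two arrows ending at each vertex, an arrow $\alpha$ is non-single if there is another arrow $\beta\ne\alpha$ with $s(\beta)=s(\alpha)$ or $t(\beta)=t(\alpha)$; otherwise it is single. A $k$-algebra is special quasi-biserial if it is Morita equivalent to some $kQ/I$, $I$ admissible, such that (1) at every vertex of $Q$ at most two arrows start and at most two arrows end; (2) for each path $p$ containing at least one non-single arrow there is at most one arrow $\beta$ with $\beta p\notin I$ and at most one arrow $\gamma$ with $p\gamma\notin I$. An indecomposable module is uniserial if it has only one composition series. An indecomposable left (resp. right) module $M$ over a finite-dimensional algebra is quasi-biserial if it is not uniserial and there exist a positive integer $m$ and uniserial left (resp. right) modules $U,V$ such that $\mathrm{rad}^m(M)=U+V$ and $M/\mathrm{rad}^m(M)$ is uniserial. A finite-dimensional algebra is quasi-biserial if every indecomposable projective left or right module is uniserial or quasi-biserial. *)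

(* Defs.v *)
From HB Require Import structures.
From mathcomp Require Import all_boot all_algebra finmap.
From mathcomp Require Import boolp.
From mathcomp Require Import monalg.

Set Implicit Arguments.
Unset Strict Implicit.
Unset Printing Implicit Defensive.

Import GRing.Theory.
Local Open Scope ring_scope.
Local Open Scope quotient_scope.

(* MathComp's [algType] requires [1 != 0]; a quotient by an arbitrary ideal and
   the path algebra of the empty quiver may be zero.  Hence a [k]-algebra is here
   a possibly zero ring with a central ring morphism from [k], and [c] in [k]
   acts on it as multiplication by [kalg_in A c]. *)
Record kalgType (k : fieldType) := KAlg {
  kalg_ring :> pzRingType;
  kalg_in : {rmorphism k -> kalg_ring};
  kalg_central : forall c x, kalg_in c * x = x * kalg_in c
}.

Arguments kalg_in {k} A : rename.

Definition finite_dimensional (k : fieldType) (A : kalgType k) : Prop :=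
  exists (n : nat) (b : 'I_n -> A),
    forall x, exists c : 'I_n -> k, x = \sum_(i < n) kalg_in A (c i) * b i.

(* A left [R]-module is an [lmodType R]; a right [R]-module is an
   [lmodType R^c], where [R^c] is the opposite ring.  Submodules are boolean
   predicates, which is no restriction in the classical setting of [boolp]. *)

Record submodule (R : pzRingType) (M : lmodType R) := Submodule {
  submod_pred :> {pred M};
  submod_predP : GRing.submod_closed submod_pred
}.

HB.instance Definition _ (R : pzRingType) (M : lmodType R) (N : submodule M) :=
  GRing.isSubmodClosed.Build R M (submod_pred N)
    (GRing.submod_closed_semi (submod_predP N)).

Section SubmoduleType.
Variables (R : pzRingType) (M : lmodType R) (N : submodule M).

Definition sub_module := {x : M | x \in submod_pred N}.
HB.instance Definition _ := SubChoice.on sub_module.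
HB.instance Definition _ := [SubChoice_isSubLmodule of sub_module by <:].
End SubmoduleType.

Section QuotientModule.
Variables (R : pzRingType) (M : lmodType R) (N : submodule M).

Definition quot_module := Quotient.quot (submod_pred N).
HB.instance Definition _ := GRing.Zmodule.on quot_module.

Let pi (x : M) : quot_module := \pi_(Quotient.quot (submod_pred N)) x.

Definition quot_scale (a : R) (u : quot_module) : quot_module :=
  pi (a *: repr u).

Let pi_eq (x y : M) : x - y \in submod_pred N -> pi x = pi y.
Proof. by rewrite Quotient.idealrBE => /eqP. Qed.

Let pi_repr (x : M) : repr (pi x) - x \in submod_pred N.
Proof. by rewrite Quotient.idealrBE reprK. Qed.

Let piD (x y : M) : pi (x + y) = pi x + pi y.
Proof. exact: raddfD. Qed.

Let piK (u : quot_module) : pi (repr u) = u.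
Proof. exact: reprK. Qed.

Let pi_scale a x : quot_scale a (pi x) = pi (a *: x).
Proof. by apply: pi_eq; rewrite -scalerBr rpredZ ?pi_repr. Qed.

Fact quot_scalerA a b u : quot_scale a (quot_scale b u) = quot_scale (a * b) u.
Proof. by rewrite -(piK u) !pi_scale scalerA. Qed.

Fact quot_scale1r : left_id 1 quot_scale.
Proof. by move=> u; rewrite -(piK u) !pi_scale scale1r. Qed.

Fact quot_scalerDr : right_distributive quot_scale +%R.
Proof.
by move=> a u v; rewrite -(piK u) -(piK v) -piD !pi_scale -piD scalerDr.
Qed.

Fact quot_scalerDl u : {morph quot_scale^~ u : a b / a + b}.
Proof. by move=> a b; rewrite -(piK u) !pi_scale -piD scalerDl. Qed.

HB.instance Definition _ := GRing.Zmodule_isLmodule.Build R quot_module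
  quot_scalerA quot_scale1r quot_scalerDr quot_scalerDl.
End QuotientModule.

Section ModuleNotions.
Variables (R : pzRingType) (M : lmodType R).
Implicit Types L N U V : submodule M.

Fact zero_submod_closed : GRing.submod_closed (pred1 (0 : M)).
Proof.
split=> [|a u v]; rewrite !inE // => /eqP -> /eqP ->.
by rewrite scaler0 addr0.
Qed.
Definition zero_submodule := Submodule zero_submod_closed.

Fact full_submod_closed : GRing.submod_closed (predT : {pred M}).
Proof. by []. Qed.
Definition full_submodule := Submodule full_submod_closed.

Definition finitely_generated : Prop :=
  exists (n : nat) (g : 'I_n -> M),
    forall x, exists a : 'I_n -> R, x = \sum_(i < n) a i *: g i.

Definition projective : Prop :=
  forall (X Y : lmodType R) (g : {linear X -> Y}) (f : {linear M -> Y}),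
    (forall y, exists x, g x = y) ->
    exists h : {linear M -> X}, forall x, g (h x) = f x.

Definition is_sum N U V : Prop :=
  forall x, x \in N <-> exists u v, [/\ u \in U, v \in V & x = u + v].

Definition indecomposable : Prop :=
  (exists x : M, x != 0) /\
  forall U V, is_sum full_submodule U V ->
    (forall x, x \in U -> x \in V -> x = 0) ->
    U =i zero_submodule \/ V =i zero_submodule.

Definition maximal_in L N : Prop :=
  [/\ {subset L <= N}, ~ {subset N <= L}
    & forall X : submodule M, {subset L <= X} -> {subset X <= N} ->
        X =i L \/ X =i N].

(* [c 0 < c 1 < ... < c n]; the values of [c] beyond [n] are irrelevant *)
Definition composition_series (n : nat) (c : nat -> submodule M) : Prop :=
  [/\ c 0%N =i zero_submodule, c n =i full_submodule
    & forall i, (i < n)%N -> maximal_in (c i) (c i.+1)].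

Definition uniserial : Prop :=
  indecomposable /\
  exists n c, composition_series n c /\
    forall n' c', composition_series n' c' ->
      n' = n /\ forall i, (i <= n)%N -> c' i =i c i.

(* the radical of the module [N], i.e. the intersection of its maximal
   submodules, as a submodule of [M] *)
Definition rad_pred N : {pred M} :=
  [pred x | (x \in N) && `[< forall L, maximal_in L N -> x \in L >]].

Fact rad_submod_closed N : GRing.submod_closed (rad_pred N).
Proof.
split=> [|a u v].
  by rewrite inE rpred0; apply/asboolP => L _; rewrite rpred0.
rewrite !inE => /andP[Nu /asboolP Lu] /andP[Nv /asboolP Lv].
rewrite rpredD ?rpredZ //=; apply/asboolP => L maxL.
by rewrite rpredD ?rpredZ ?Lu ?Lv.
Qed.
Definition rad N := Submodule (rad_submod_closed N).

Definition radn (m : nat) : submodule M := iter m rad full_submodule.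

End ModuleNotions.

Arguments zero_submodule {R} M.
Arguments full_submodule {R} M.
Arguments radn {R} M m.

Definition quasi_biserial_module (R : pzRingType) (M : lmodType R) : Prop :=
  [/\ indecomposable M, ~ uniserial M
    & exists (m : nat) (U V : submodule M),
        [/\ (0 < m)%N,
            uniserial (sub_module U) /\ uniserial (sub_module V),
            is_sum (radn M m) U V
          & uniserial (quot_module (radn M m))]].

Definition projectives_quasi_biserial (R : pzRingType) : Prop :=
  forall P : lmodType R, finitely_generated P -> indecomposable P ->
    projective P -> uniserial P \/ quasi_biserial_module P.

Definition quasi_biserial_algebra (k : fieldType) (A : kalgType k) : Prop :=
  [/\ finite_dimensional A,
      projectives_quasi_biserial A
    & projectives_quasi_biserial A^c].

(* Morita equivalence is [k]-linear equivalence of the categories of finitely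
   generated left modules. *)

Record fgmod (R : pzRingType) := FgMod {
  fgmod_sort :> lmodType R;
  fgmodP : finitely_generated fgmod_sort
}.

Section Functors.
Variables (k : fieldType).

(* [c] in [k] acts on Hom_A(M, N) by [(c f)(x) = kalg_in A c *: f x];
   [lfun_lin] states [k]-linearity of the action on morphisms pointwise, as
   [F(c f + g) = c F(f) + F(g)]. *)
Record lfunctor (A B : kalgType k) := LFunctor {
  lfun_obj :> fgmod A -> fgmod B;
  lfun_hom : forall M N : fgmod A,
    {linear M -> N} -> {linear lfun_obj M -> lfun_obj N};
  lfun_id : forall (M : fgmod A) (f : {linear M -> M}),
    f =1 id -> lfun_hom f =1 id;
  lfun_comp : forall (L M N : fgmod A) (f : {linear L -> M})
      (g : {linear M -> N}) (h : {linear L -> N}),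
    h =1 g \o f -> lfun_hom h =1 lfun_hom g \o lfun_hom f;
  lfun_lin : forall (M N : fgmod A) (c : k) (f g h : {linear M -> N}),
    (forall x, h x = kalg_in A c *: f x + g x) ->
    forall y, lfun_hom h y
      = kalg_in B c *: lfun_hom f y + lfun_hom g y
}.

Definition natural_iso_id (A B : kalgType k) (F : lfunctor A B)
    (G : lfunctor B A) : Prop :=
  exists eta : forall M : fgmod A, {linear M -> G (F M)},
    (forall M, bijective (eta M)) /\
    forall (M N : fgmod A) (f : {linear M -> N}),
      eta N \o f =1 lfun_hom G (lfun_hom F f) \o eta M.

Definition morita_equivalent (A B : kalgType k) : Prop :=
  exists (F : lfunctor A B) (G : lfunctor B A),
    natural_iso_id F G /\ natural_iso_id G F.
End Functors.

Record ideal (R : pzRingType) := Ideal {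
  ideal_pred :> {pred R};
  ideal_zmod : zmod_closed ideal_pred;
  idealMl : forall a x, x \in ideal_pred -> a * x \in ideal_pred;
  idealMr : forall a x, x \in ideal_pred -> x * a \in ideal_pred
}.

HB.instance Definition _ (R : pzRingType) (I : ideal R) :=
  GRing.isZmodClosed.Build R (ideal_pred I) (ideal_zmod I).

Section GeneratedIdeal.
Variable R : pzRingType.

Definition ideal_gen_pred (S : R -> Prop) : {pred R} :=
  fun x => `[< forall J : ideal R, (forall y, S y -> y \in J) -> x \in J >].

Fact ideal_gen_zmod S : zmod_closed (ideal_gen_pred S).
Proof.
split=> [|x y /asboolP Jx /asboolP Jy]; apply/asboolP => J SJ.
  exact: rpred0.
by rewrite rpredB ?Jx ?Jy.
Qed.

Fact ideal_genMl S a x :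
  x \in ideal_gen_pred S -> a * x \in ideal_gen_pred S.
Proof. by move=> /asboolP Jx; apply/asboolP => J SJ; apply/idealMl/Jx. Qed.

Fact ideal_genMr S a x :
  x \in ideal_gen_pred S -> x * a \in ideal_gen_pred S.
Proof. by move=> /asboolP Jx; apply/asboolP => J SJ; apply/idealMr/Jx. Qed.

Definition ideal_gen S : ideal R :=
  Ideal (ideal_gen_zmod S) (@ideal_genMl S) (@ideal_genMr S).

Definition ideal_mul (I J : ideal R) : ideal R :=
  ideal_gen (fun z => exists x y, [/\ x \in I, y \in J & z = x * y]).

Definition ideal_pow (I : ideal R) (n : nat) : ideal R :=
  iter n (ideal_mul I) (ideal_gen (fun=> True)).
End GeneratedIdeal.

Section QuotientRing.
Variables (A : pzRingType) (I : ideal A).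

Definition quot_ring := Quotient.quot (ideal_pred I).
HB.instance Definition _ := GRing.Zmodule.on quot_ring.

Definition quot_pi (x : A) : quot_ring := \pi_(Quotient.quot (ideal_pred I)) x.

Definition qring_one : quot_ring := quot_pi 1.
Definition qring_mul (u v : quot_ring) : quot_ring := quot_pi (repr u * repr v).

Let pi_eq (x y : A) : x - y \in ideal_pred I -> quot_pi x = quot_pi y.
Proof. by rewrite Quotient.idealrBE => /eqP. Qed.

Let pi_repr (x : A) : repr (quot_pi x) - x \in ideal_pred I.
Proof. by rewrite Quotient.idealrBE reprK. Qed.

Let piD (x y : A) : quot_pi (x + y) = quot_pi x + quot_pi y.
Proof. exact: raddfD. Qed.

Let piK (u : quot_ring) : quot_pi (repr u) = u.
Proof. exact: reprK. Qed.

Let piM x y : qring_mul (quot_pi x) (quot_pi y) = quot_pi (x * y).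
Proof.
apply: pi_eq; rewrite -(subrK (x * repr (quot_pi y)) (_ * repr (quot_pi y))).
rewrite -mulrBl -addrA -mulrBr; apply: rpredD.
  by apply: idealMr; apply: pi_repr.
by apply: idealMl; apply: pi_repr.
Qed.

Fact qring_mulA : associative qring_mul.
Proof.
by move=> x y z; rewrite -(piK x) -(piK y) -(piK z) !piM mulrA.
Qed.

Fact qring_mul1r : left_id qring_one qring_mul.
Proof. by move=> x; rewrite -(piK x) !piM mul1r. Qed.

Fact qring_mulr1 : right_id qring_one qring_mul.
Proof. by move=> x; rewrite -(piK x) !piM mulr1. Qed.

Fact qring_mulrDl : left_distributive qring_mul +%R.
Proof.
move=> x y z; rewrite -(piK x) -(piK y) -(piK z).
by rewrite -piD !piM -piD mulrDl.
Qed.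

Fact qring_mulrDr : right_distributive qring_mul +%R.
Proof.
move=> x y z; rewrite -(piK x) -(piK y) -(piK z).
by rewrite -piD !piM -piD mulrDr.
Qed.

HB.instance Definition _ := GRing.Zmodule_isPzRing.Build quot_ring
  qring_mulA qring_mul1r qring_mulr1 qring_mulrDl qring_mulrDr.


Fact quot_pi_zmod : zmod_morphism quot_pi.
Proof. exact: raddfB. Qed.
HB.instance Definition _ :=
  GRing.isZmodMorphism.Build A quot_ring quot_pi quot_pi_zmod.

Fact quot_pi_monoid : monoid_morphism quot_pi.
Proof. by split=> // x y; rewrite -piM. Qed.
HB.instance Definition _ :=
  GRing.isMonoidMorphism.Build A quot_ring quot_pi quot_pi_monoid.

Lemma quot_pi_surj (u : quot_ring) : quot_pi (repr u) = u.
Proof. exact: piK. Qed.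
End QuotientRing.

Section QuotientAlgebra.
Variables (k : fieldType) (A : kalgType k) (I : ideal A).

Fact quot_alg_central (c : k) (u : quot_ring I) :
  (quot_pi I \o kalg_in A) c * u = u * (quot_pi I \o kalg_in A) c.
Proof. by rewrite /= -(quot_pi_surj u) -!rmorphM kalg_central. Qed.

Definition quot_alg : kalgType k := KAlg quot_alg_central.
End QuotientAlgebra.

Record quiver := Quiver {
  vertex : finType;
  arrow : finType;
  src : arrow -> vertex;
  tgt : arrow -> vertex
}.

Section Paths.
Variable Q : quiver.

Fixpoint composable (i : vertex Q) (s : seq (arrow Q)) : bool :=
  if s is a :: s' then (src a == i) && composable (tgt a) s' else true.

(* A path is its starting vertex together with its arrows in the order in which
   they are traversed: the path written a_n ... a_2 a_1 from right to left is
   [(src a_1, [:: a_1; a_2; ...; a_n])], and [(i, [::])] is the trivial path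
   at [i]. *)
Record qpath := QPath {
  qpath_val : vertex Q * seq (arrow Q);
  _ : composable qpath_val.1 qpath_val.2
}.
HB.instance Definition _ := [isSub for qpath_val].
HB.instance Definition _ := [Countable of qpath by <:].

Definition psrc (p : qpath) : vertex Q := (qpath_val p).1.
Definition parrows (p : qpath) : seq (arrow Q) := (qpath_val p).2.
Definition ptgt (p : qpath) : vertex Q :=
  last (psrc p) (map (@tgt Q) (parrows p)).

Definition trivial_path (i : vertex Q) : qpath := @QPath (i, [::]) isT.

Fact arrow_path_subproof (a : arrow Q) : composable (src a) [:: a].
Proof. by rewrite /= eqxx. Qed.
Definition arrow_path (a : arrow Q) : qpath :=
  @QPath (src a, [:: a]) (arrow_path_subproof a).

Lemma composable_cat i s1 s2 :
  composable i (s1 ++ s2)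
  = composable i s1 && composable (last i (map (@tgt Q) s1)) s2.
Proof. by elim: s1 i => //= a s1 IH i; rewrite IH andbA. Qed.

Fact pcomp_subproof (p q : qpath) : psrc p = ptgt q ->
  composable (psrc q, parrows q ++ parrows p).1
             (psrc q, parrows q ++ parrows p).2.
Proof.
move=> pq; rewrite /= composable_cat -/(ptgt q) -pq.
by apply/andP; split; [exact: (valP q) | exact: (valP p)].
Qed.

(* The product [p q] is "first [q], then [p]"; [None] if they do not compose. *)
Definition pcomp (p q : qpath) : option qpath :=
  if psrc p =P ptgt q is ReflectT pq then Some (QPath (pcomp_subproof pq))
  else None.

Lemma pcomp_some (p q : qpath) : psrc p = ptgt q ->
  exists2 r, pcomp p q = Some r
           & qpath_val r = (psrc q, parrows q ++ parrows p).
Proof. by rewrite /pcomp; case: eqP => // pq _; eexists. Qed.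

Lemma pcomp_none (p q : qpath) : psrc p <> ptgt q -> pcomp p q = None.
Proof. by rewrite /pcomp; case: eqP. Qed.

Lemma pcompA (p q r : qpath) :
  obind (pcomp p) (pcomp q r) = obind (pcomp^~ r) (pcomp p q).
Proof.
have tgt_comp (x y z : qpath) :
    qpath_val z = (psrc y, parrows y ++ parrows x) -> psrc x = ptgt y ->
    ptgt z = ptgt x.
  move=> Ez xy; rewrite {1}/ptgt {1}/psrc {1}/parrows Ez /= map_cat last_cat.
  by rewrite -/(ptgt y) -xy.
have src_comp (x y z : qpath) :
    qpath_val z = (psrc y, parrows y ++ parrows x) -> psrc z = psrc y.
  by rewrite /psrc => ->.
have [qr|qr] := eqVneq (psrc q) (ptgt r); last first.
  rewrite (pcomp_none (elimN eqP qr)) /=.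
  have [pq|pq] := eqVneq (psrc p) (ptgt q); last first.
    by rewrite (pcomp_none (elimN eqP pq)).
  have [s -> Es] /= := pcomp_some pq.
  by rewrite pcomp_none // (src_comp _ _ _ Es); apply/eqP.
have [t Et Vt] := pcomp_some qr; rewrite Et /=.
have [pq|pq] := eqVneq (psrc p) (ptgt q); last first.
  rewrite (pcomp_none (elimN eqP pq)) /= pcomp_none //.
  by rewrite (tgt_comp _ _ _ Vt qr); apply/eqP.
have [s Es Vs] := pcomp_some pq; rewrite Es /=.
have pt : psrc p = ptgt t by rewrite (tgt_comp _ _ _ Vt qr).
have sr : psrc s = ptgt r by rewrite (src_comp _ _ _ Vs).
have [u -> Vu] := pcomp_some pt; have [v -> Vv] := pcomp_some sr.
congr Some; apply: val_inj; rewrite /= Vu Vv /psrc /parrows Vt Vs /=.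
by rewrite catA.
Qed.

Lemma pcomp_trivl (i : vertex Q) (p : qpath) :
  pcomp (trivial_path i) p = if ptgt p == i then Some p else None.
Proof.
have [pi|/eqP npi] := eqVneq (ptgt p) i; last first.
  by apply: pcomp_none => ip; case: npi; rewrite -ip.
have [|r -> Er] := @pcomp_some (trivial_path i) p; first by rewrite pi.
by congr Some; apply: val_inj; rewrite /= Er /= cats0; case: (p) => [[]].
Qed.

Lemma pcomp_trivr (i : vertex Q) (p : qpath) :
  pcomp p (trivial_path i) = if psrc p == i then Some p else None.
Proof.
have [pi|/eqP npi] := eqVneq (psrc p) i; last by apply: pcomp_none.
have [//|r -> Er] := @pcomp_some p (trivial_path i).
congr Some; apply: val_inj; rewrite /= Er /= -pi.
by rewrite /psrc /parrows; case: (p) => [[]].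
Qed.
End Paths.

Lemma bilinear_assoc (k : fieldType) (V : lmodType k) (T : Type) (e : T -> V)
    (m : V -> V -> V) :
  left_distributive m +%R -> right_distributive m +%R ->
  (forall c x y, c *: m x y = m (c *: x) y) ->
  (forall c x y, c *: m x y = m x (c *: y)) ->
  (forall x, exists (s : seq T) (c : T -> k), x = \sum_(t <- s) c t *: e t) ->
  (forall t u v, m (e t) (m (e u) (e v)) = m (m (e t) (e u)) (e v)) ->
  associative m.
Proof.
move=> mDl mDr mZl mZr span mA.
have m0l y : m 0 y = 0 by rewrite -(scale0r (0 : V)) -mZl !scale0r.
have m0r y : m y 0 = 0 by rewrite -(scale0r (0 : V)) -mZr !scale0r.
have suml s (F : T -> V) y : m (\sum_(t <- s) F t) y = \sum_(t <- s) m (F t) y.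
  by apply: (big_morph (m^~ y)) => // u v; apply: mDl.
have sumr s (F : T -> V) y : m y (\sum_(t <- s) F t) = \sum_(t <- s) m y (F t).
  by apply: (big_morph (m y)) => // u v; apply: mDr.
have msl s (c : T -> k) y :
    m (\sum_(t <- s) c t *: e t) y = \sum_(t <- s) c t *: m (e t) y.
  by rewrite suml; apply: eq_bigr => t _; rewrite mZl.
have msr s (c : T -> k) y :
    m y (\sum_(t <- s) c t *: e t) = \sum_(t <- s) c t *: m y (e t).
  by rewrite sumr; apply: eq_bigr => t _; rewrite mZr.
move=> x y z; have [s1 [c1 ->]] := span x.
rewrite !msl suml; apply: eq_bigr => t _; rewrite -mZl; congr (_ *: _).
have [s2 [c2 ->]] := span y; rewrite msl msr sumr suml.
apply: eq_bigr => u _; rewrite -mZl -mZr; congr (_ *: _).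
have [s3 [c3 ->]] := span z; rewrite !msr sumr.
by apply: eq_bigr => v _; rewrite -mZr mA.
Qed.

Definition path_ring (k : fieldType) (Q : quiver) := {malg k[qpath Q]}.

HB.instance Definition _ (k : fieldType) (Q : quiver) :=
  GRing.Lmodule.copy (path_ring k Q) {malg k[qpath Q]}.

HB.lock Definition path_elt (k : fieldType) (Q : quiver) (p : qpath Q)
  : path_ring k Q := mkmalgU p 1.
Arguments path_elt k {Q} p.
Canonical path_elt_unlockable := Unlockable path_elt.unlock.

Definition path_prod (k : fieldType) (Q : quiver) (p q : qpath Q)
  : path_ring k Q := oapp (path_elt k) 0 (pcomp p q).

HB.lock Definition pa_mul (k : fieldType) (Q : quiver) (f g : path_ring k Q)
  : path_ring k Q :=
  \sum_(p <- msupp f) \sum_(q <- msupp g) (f@_p * g@_q) *: path_prod k p q.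
Arguments pa_mul {k Q} f g.
Canonical pa_mul_unlockable := Unlockable pa_mul.unlock.

Definition pa_one (k : fieldType) (Q : quiver) : path_ring k Q :=
  \sum_(i : vertex Q) path_elt k (trivial_path i).

Section PathAlgebra.
Variables (k : fieldType) (Q : quiver).
Local Notation kQ := (path_ring k Q).
Local Notation path_elt := (path_elt k).
Local Notation path_prod := (path_prod k).
Local Notation pa_mul := (@pa_mul k Q).
Local Notation pa_one := (pa_one k Q).

Let pa_mulw (d1 d2 : {fset qpath Q}) (f g : kQ) :
  (msupp f `<=` d1)%fset -> (msupp g `<=` d2)%fset ->
  pa_mul f g = \sum_(p <- d1) \sum_(q <- d2) (f@_p * g@_q) *: path_prod p q.
Proof.
move=> le1 le2; rewrite pa_mul.unlock (big_fset_incl _ le1) /=.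
  apply/eq_bigr => p _; apply/big_fset_incl => // q _ /mcoeff_outdom ->.
  by rewrite mulr0 scale0r.
move=> p _ /mcoeff_outdom fp; rewrite big1 // => q _.
by rewrite fp mul0r scale0r.
Qed.

Fact pa_mulDl : left_distributive pa_mul +%R.
Proof.
move=> f1 f2 g; set d := (msupp f1 `|` msupp f2)%fset.
rewrite (@pa_mulw d (msupp g) (f1 + f2)) ?msuppD_le ?fsubset_refl //.
rewrite (@pa_mulw d (msupp g) f1) ?fsubsetUl ?fsubset_refl //.
rewrite (@pa_mulw d (msupp g) f2) ?fsubsetUr ?fsubset_refl //.
rewrite -big_split /=; apply/eq_bigr => p _.
rewrite -big_split /=; apply/eq_bigr => q _.
by rewrite mcoeffD mulrDl scalerDl.
Qed.

Fact pa_mulDr : right_distributive pa_mul +%R.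
Proof.
move=> f g1 g2; set d := (msupp g1 `|` msupp g2)%fset.
rewrite (@pa_mulw (msupp f) d f (g1 + g2)) ?msuppD_le ?fsubset_refl //.
rewrite (@pa_mulw (msupp f) d f g1) ?fsubsetUl ?fsubset_refl //.
rewrite (@pa_mulw (msupp f) d f g2) ?fsubsetUr ?fsubset_refl //.
rewrite -big_split /=; apply/eq_bigr => p _.
rewrite -big_split /=; apply/eq_bigr => q _.
by rewrite mcoeffD mulrDr scalerDl.
Qed.

Fact pa_scalerAl (c : k) (f g : kQ) : c *: pa_mul f g = pa_mul (c *: f) g.
Proof.
rewrite [RHS](@pa_mulw (msupp f) (msupp g)) ?msuppZ_le ?fsubset_refl //.
rewrite pa_mul.unlock scaler_sumr; apply/eq_bigr => p _.
rewrite scaler_sumr; apply/eq_bigr => q _.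
by rewrite mcoeffZ scalerA mulrA.
Qed.

Fact pa_scalerAr (c : k) (f g : kQ) : c *: pa_mul f g = pa_mul f (c *: g).
Proof.
rewrite [RHS](@pa_mulw (msupp f) (msupp g)) ?msuppZ_le ?fsubset_refl //.
rewrite pa_mul.unlock scaler_sumr; apply/eq_bigr => p _.
rewrite scaler_sumr; apply/eq_bigr => q _.
by rewrite mcoeffZ scalerA mulrCA.
Qed.

Let pa_mul0g (g : kQ) : pa_mul 0 g = 0.
Proof. by rewrite -(scale0r (0 : kQ)) -pa_scalerAl !scale0r. Qed.

Let pa_mulg0 (g : kQ) : pa_mul g 0 = 0.
Proof. by rewrite -(scale0r (0 : kQ)) -pa_scalerAr !scale0r. Qed.

Lemma pa_mulE p q : pa_mul (path_elt p) (path_elt q) = path_prod p q.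
Proof.
rewrite path_elt.unlock (@pa_mulw [fset p]%fset [fset q]%fset) ?msuppU_le // !big_seq_fset1.
by rewrite !mcoeffUU mulr1 scale1r.
Qed.

Let kQE (f : kQ) : f = \sum_(p <- msupp f) f@_p *: path_elt p.
Proof.
rewrite [LHS]monalgE; apply/eq_bigr => p _; apply/malgP => q.
rewrite [RHS]mcoeffZ path_elt.unlock.
have E (c : k) : (mkmalgU p c)@_q = c *+ (p == q) by exact: mcoeffU.
have H (c : k) (b : bool) : c *+ b = c * (1 *+ b) by rewrite mulrnAr mulr1.
exact: (etrans (E f@_p) (etrans (H _ _) (congr1 ( *%R f@_p) (esym (E 1))))).
Qed.

Let pa_suml (T : Type) (s : seq T) (F : T -> kQ) g :
  pa_mul (\sum_(i <- s) F i) g = \sum_(i <- s) pa_mul (F i) g.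
Proof.
by apply: (big_morph (pa_mul^~ g)) => [x y|]; rewrite ?pa_mulDl ?pa_mul0g.
Qed.

Let pa_sumr (T : Type) (s : seq T) (F : T -> kQ) g :
  pa_mul g (\sum_(i <- s) F i) = \sum_(i <- s) pa_mul g (F i).
Proof.
by apply: (big_morph (pa_mul g)) => [x y|]; rewrite ?pa_mulDr ?pa_mulg0.
Qed.

Let pa_mulA_path p q r :
  pa_mul (path_elt p) (pa_mul (path_elt q) (path_elt r))
  = pa_mul (pa_mul (path_elt p) (path_elt q)) (path_elt r).
Proof.
rewrite !pa_mulE /path_prod; have := pcompA p q r.
case: (pcomp q r) => [s|] /=; case: (pcomp p q) => [t|] //=.
- by move=> E; rewrite !pa_mulE /path_prod E.
- by move=> E; rewrite pa_mulE /path_prod E pa_mul0g.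
- by move=> E; rewrite pa_mulE /path_prod -E pa_mulg0.
- by rewrite pa_mul0g pa_mulg0.
Qed.

Fact pa_mulA : associative pa_mul.
Proof.
apply: (bilinear_assoc (e := path_elt) pa_mulDl pa_mulDr pa_scalerAl pa_scalerAr).
  by move=> f; exists (msupp f : seq _), (fun p => f@_p); apply: kQE.
exact: pa_mulA_path.
Qed.

Fact pa_mul1r : left_id pa_one pa_mul.
Proof.
move=> f; rewrite (kQE f) pa_sumr; apply/eq_bigr => p _.
rewrite -pa_scalerAr; congr (_ *: _); rewrite /pa_one pa_suml.
rewrite (bigD1 (ptgt p)) //= pa_mulE /path_prod pcomp_trivl eqxx /=.
rewrite big1 ?addr0 // => i ip.
by rewrite pa_mulE /path_prod pcomp_trivl eq_sym (negbTE ip).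
Qed.

Fact pa_mulr1 : right_id pa_one pa_mul.
Proof.
move=> f; rewrite (kQE f) pa_suml; apply/eq_bigr => p _.
rewrite -pa_scalerAl; congr (_ *: _); rewrite /pa_one pa_sumr.
rewrite (bigD1 (psrc p)) //= pa_mulE /path_prod pcomp_trivr eqxx /=.
rewrite big1 ?addr0 // => i ip.
by rewrite pa_mulE /path_prod pcomp_trivr eq_sym (negbTE ip).
Qed.

HB.instance Definition _ := GRing.Zmodule_isPzRing.Build kQ
  pa_mulA pa_mul1r pa_mulr1 pa_mulDl pa_mulDr.

Definition pa_in (c : k) : kQ := c *: pa_one.

Fact pa_in_zmod : zmod_morphism pa_in.
Proof. by move=> c d; rewrite /pa_in scalerBl. Qed.
HB.instance Definition _ := GRing.isZmodMorphism.Build k kQ pa_in pa_in_zmod.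

Fact pa_in_monoid : monoid_morphism pa_in.
Proof.
split=> [|c d]; first exact: scale1r.
have -> : pa_in c * pa_in d = pa_mul (pa_in c) (pa_in d) by [].
rewrite /pa_in -(pa_scalerAl c pa_one).
by rewrite -(pa_scalerAr d pa_one pa_one) pa_mul1r scalerA.
Qed.
HB.instance Definition _ := GRing.isMonoidMorphism.Build k kQ pa_in pa_in_monoid.

Fact pa_in_central (c : k) (x : kQ) : pa_in c * x = x * pa_in c.
Proof.
have -> : pa_in c * x = pa_mul (pa_in c) x by [].
have -> : x * pa_in c = pa_mul x (pa_in c) by [].
rewrite /pa_in.
by rewrite -(pa_scalerAl c pa_one x) -(pa_scalerAr c x pa_one) pa_mul1r pa_mulr1.
Qed.

Definition path_alg : kalgType k := KAlg pa_in_central.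

Definition arrow_elt (a : arrow Q) : kQ := path_elt (arrow_path a).

Definition arrow_ideal : ideal path_alg := ideal_gen (fun x => exists a, x = arrow_elt a).

Definition admissible (I : ideal path_alg) : Prop :=
  exists2 m, (2 <= m)%N
    & {subset ideal_pow arrow_ideal m <= I} /\
      {subset I <= ideal_pow arrow_ideal 2}.

End PathAlgebra.

Definition at_most_two_arrows (Q : quiver) : Prop :=
  forall i : vertex Q,
    (#|[pred a : arrow Q | src a == i]| <= 2)%N /\
    (#|[pred a : arrow Q | tgt a == i]| <= 2)%N.

Definition non_single (Q : quiver) (a : arrow Q) : bool :=
  [exists b : arrow Q, (b != a) && ((src b == src a) || (tgt b == tgt a))].

(* A product of non-composable paths is zero in kQ, hence lies in [I]. *)
Definition unique_continuation (k : fieldType) (Q : quiver)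
    (I : ideal (path_alg k Q)) : Prop :=
  forall p : qpath Q, has (@non_single Q) (parrows p) ->
    (forall b b' : arrow Q,
       arrow_elt k b * path_elt k p \notin I ->
       arrow_elt k b' * path_elt k p \notin I -> b = b') /\
    (forall c c' : arrow Q,
       path_elt k p * arrow_elt k c \notin I ->
       path_elt k p * arrow_elt k c' \notin I -> c = c').

Definition special_quasi_biserial (k : fieldType) (A : kalgType k) : Prop :=
  exists (Q : quiver) (I : ideal (path_alg k Q)),
    [/\ admissible I, at_most_two_arrows Q, unique_continuation I
      & morita_equivalent A (quot_alg I)].

(* Main.v *)
From HB Require Import structures.
From mathcomp Require Import all_boot all_algebra finmap.
From mathcomp Require Import boolp.
From mathcomp Require Import monalg.
Require Import Defs.

Set Implicit Arguments.
Unset Strict Implicit.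
Unset Printing Implicit Defensive.

Import GRing.Theory.
Local Open Scope ring_scope.
Local Open Scope quotient_scope.

(** Call a word in the arrows of a quiver nonzero on a module element [w] when
    the corresponding product of arrows does not kill [w].

    Let [P] be an indecomposable projective module over a special
    quasi-biserial algebra [k Q / I].  It is generated by an element [w]
    concentrated at one vertex.  If every word has at most one arrow continuing
    it to a nonzero word on [w], the successive products form a chain and [P] is
    uniserial ([uniserial_of_unique]).  Otherwise take a shortest word [s] with
    two nonzero continuations [b] and [b'].  Up to the length [m] of [s] the
    radical layers of [P] still form a chain, so [P / rad^(m+1) P] is uniserial,
    and [rad^(m+1) P] is generated by [b s w] and [b' s w] because no third
    arrow leaves the end of [s].  As [b] and [b'] start at the same vertex they
    are non-single; hence every word through [b] or [b'] has at most one
    continuation, and the two submodules they generate are uniserial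
    ([uniserial_or_quasi_biserial]).

    The condition on [Q] and [I] is assumed only up to Morita equivalence: the
    algebra [A = k Q / I] is equivalent to some [B = k Q' / I'] for which it
    holds, and the equivalence concerns left modules only.  Both algebras are
    basic, and equivalent basic algebras are isomorphic ([morita_basic_iso]).
    Thus [A] itself is a quotient of [k Q'] by [I'].

    What the module-theoretic argument needs is collected in the record
    [quiver_ring], which makes no reference to the field and passes to the
    opposite ring and the opposite quiver.  The case of right modules then
    follows from the case of left modules. *)


(** * Uniserial modules from chains of submodules *)

Section Chains.
Variables (R : pzRingType) (M : lmodType R).

(** Consecutive members of such a chain have nothing between them, so that a
    composition series must pass through all of them; and of two summands one
    contains the other, so that a direct decomposition is trivial. *)
Lemma uniserial_of_chain (n : nat) (c : nat -> submodule M) :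
  (0 < n)%N -> c 0%N =i zero_submodule M -> c n =i full_submodule M ->
  (forall i, (i < n)%N -> {subset c i <= c i.+1}) ->
  (forall i, (i < n)%N -> ~ {subset c i.+1 <= c i}) ->
  (forall X : submodule M, exists2 i, (i <= n)%N & X =i c i) ->
  uniserial M.
Proof.
move=> n_gt0 c0 cn cS cnS cX.
have c_le i j : (i <= j)%N -> (j <= n)%N -> {subset c i <= c j}.
  elim: j => [|j IH]; first by rewrite leqn0 => /eqP -> _ x.
  rewrite leq_eqVlt => /predU1P[-> _ x //|ij] jn x xi.
  by apply: (cS j jn); apply: (IH ij (ltnW jn)).
have c_lt i j : (i < j)%N -> (j <= n)%N -> ~ {subset c j <= c i}.
  move=> ij jn ji; apply: (cnS i (leq_trans ij jn)) => x xi.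
  by apply: ji; apply: (c_le i.+1).
have c_inj i j : (i <= n)%N -> (j <= n)%N -> c i =i c j -> i = j.
  move=> iN jN ij; case: (ltngtP i j) => // lt_ij.
    by case: (c_lt _ _ lt_ij jN) => x; rewrite ij.
  by case: (c_lt _ _ lt_ij iN) => x; rewrite ij.
split.
  split.
    apply: contrapT => M0; apply: (cnS 0%N n_gt0) => x _.
    rewrite c0 !inE; apply: contrapT => /negP x0.
    by apply: M0; exists x.
  move=> U V UV UV0.
  have [i iN Ui] := cX U; have [j jN Vj] := cX V.
  case: (leqP i j) => ij.
    left=> x; rewrite inE; apply/idP/eqP => [xU|->]; last exact: rpred0.
    by apply: UV0 => //; rewrite Vj; apply: (c_le i) => //; rewrite -Ui.
  right=> x; rewrite inE; apply/idP/eqP => [xV|->]; last exact: rpred0.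
  by apply: UV0 => //; rewrite Ui; apply: (c_le j) => //; [apply: ltnW | rewrite -Vj].
exists n, c; split.
  split=> // i iN; split; [exact: cS | exact: cnS |] => X ciX Xci.
  have [j jN Xj] := cX X.
  case: (leqP j i) => ji.
    left=> x; apply/idP/idP => [|/ciX //].
    by rewrite Xj; apply: c_le => //; apply: ltnW.
  right=> x; apply/idP/idP => [/Xci //|].
  by rewrite Xj; apply: c_le.
move=> n' c' [c'0 c'n c'S].
have step i : (i <= n')%N -> (i <= n)%N /\ c' i =i c i.
  elim: i => [|i IH] iN'; first by split=> // x; rewrite c'0 c0.
  have [iN ci] := IH (ltnW iN').
  have [c'iS c'niS c'max] := c'S i iN'.
  have [j jN cj] := cX (c' i.+1).
  have ij : (i < j)%N.
    rewrite ltnNge; apply/negP => ji; apply: c'niS => x.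
    by rewrite cj ci; apply: c_le.
  have iSn : (i.+1 <= n)%N by apply: leq_trans jN.
  case: (c'max (c i.+1)).
  - by move=> x; rewrite ci; apply: cS.
  - by move=> x; rewrite cj; apply: c_le.
  - by move=> E; case: (cnS i) => // x; rewrite E ci.
  by move=> E; split=> // x; rewrite E.
have [n'n cn'] := step n' (leqnn _).
have E : n' = n.
  by apply: c_inj => // x; rewrite -cn' c'n cn.
by split=> // i iN; have [] := step i; rewrite ?E.
Qed.

Definition cyclic_pred (v : M) : {pred M} :=
  [pred y | `[< exists r, y = r *: v >]].

Fact cyclic_closed v : GRing.submod_closed (cyclic_pred v).
Proof.
split=> [|a y z]; first by rewrite inE; apply/asboolP; exists 0; rewrite scale0r.
rewrite !inE => /asboolP[r ->] /asboolP[s ->]; apply/asboolP.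
by exists (a * r + s); rewrite scalerDl scalerA.
Qed.
Definition cyclic v := Submodule (cyclic_closed v).

Lemma cyclicP v y : reflect (exists r, y = r *: v) (y \in cyclic v).
Proof. by rewrite inE; apply: asboolP. Qed.

Lemma cyclic_id v : v \in cyclic v.
Proof. by apply/cyclicP; exists 1; rewrite scale1r. Qed.

Lemma cyclic_sub v (X : submodule M) : v \in X -> {subset cyclic v <= X}.
Proof. by move=> vX y /cyclicP[r ->]; apply: rpredZ. Qed.

End Chains.

(** * Rings presented by a quiver *)

(** What remains of an admissible quotient of a path algebra: [J] plays the part
    of the arrow ideal.  The fields [qr_locl] and [qr_locr] replace the
    decomposition [R = (+)_i k e_i + J], so that no base field is needed and
    the notion is visibly self-dual; [qr_comm] says that the algebra is basic. *)
Record quiver_ring (R : pzRingType) (Q : quiver) (e : vertex Q -> R)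
    (x : arrow Q -> R) (J : R -> Prop) : Prop := QuiverRing {
  qr_sum1 : \sum_i e i = 1;
  qr_orth : forall i j, e i * e j = if i == j then e i else 0;
  qr_tgt : forall a, e (tgt a) * x a = x a;
  qr_src : forall a, x a * e (src a) = x a;
  qr_J0 : J 0;
  qr_JD : forall y z, J y -> J z -> J (y + z);
  qr_JMl : forall r z, J z -> J (r * z);
  qr_JMr : forall r z, J z -> J (z * r);
  qr_arrow : forall a, J (x a);
  qr_genl : forall z, J z -> exists y, z = \sum_a y a * x a;
  qr_genr : forall z, J z -> exists y, z = \sum_a x a * y a;
  qr_nil : exists m, forall s : seq R, size s = m ->
    (forall z, z \in s -> J z) -> \prod_(z <- s) z = 0;
  qr_locl : forall i r, J (r * e i) \/ exists r', r' * (r * e i) = e i;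
  qr_locr : forall i r, J (e i * r) \/ exists r', (e i * r) * r' = e i;
  qr_comm : forall r r', J (r * r' - r' * r)
}.

(** The element of [R] given by a word in the arrows, listed in the order of
    traversal: [a_1, ..., a_n] stands for [x a_n * ... * x a_1]. *)
Definition word_elt (R : pzRingType) (Q : quiver) (x : arrow Q -> R)
  (s : seq (arrow Q)) : R := \prod_(a <- rev s) x a.

(** The second condition of special quasi-biserial algebras; words that are not
    paths give the product [0] and satisfy it vacuously. *)
Definition unique_words (R : pzRingType) (Q : quiver) (x : arrow Q -> R) :=
  forall s, has (@non_single Q) s ->
    (forall b b', x b * word_elt x s <> 0 -> x b' * word_elt x s <> 0 ->
       b = b') /\
    (forall c c', word_elt x s * x c <> 0 -> word_elt x s * x c' <> 0 ->
       c = c').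

(** The inverse is given by the geometric series. *)
Lemma nilpotent_unit (R : pzRingType) (z : R) m : z ^+ m = 0 ->
  exists r, r * (1 + z) = 1 /\ (1 + z) * r = 1.
Proof.
move=> zm; pose r := \sum_(i < m) (- z) ^+ i; exists r.
have C : GRing.comm (1 + z) r.
  apply: commr_sum => i _; apply: commrX; apply: commrN.
  by apply: commr_sym; apply: commrD; [apply: commr1 | apply: commr_refl].
have E : (1 + z) * r = 1.
  have := subrX1 (- z) m; rewrite exprNn zm mulr0 sub0r -/r.
  by rewrite -opprD mulNr addrC => /oppr_inj.
by rewrite -[r * _]C.
Qed.

Section QuiverRing.
Variables (R : pzRingType) (Q : quiver).
Variables (e : vertex Q -> R) (x : arrow Q -> R) (J : R -> Prop).
Hypothesis RJ : quiver_ring e x J.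
Local Notation word := (word_elt x).

Lemma word_nil : word [::] = 1.
Proof. by rewrite /word_elt big_nil. Qed.

Lemma word_rcons s a : word (rcons s a) = x a * word s.
Proof. by rewrite /word_elt rev_rcons big_cons. Qed.

Lemma word_cat s1 s2 : word (s1 ++ s2) = word s2 * word s1.
Proof. by rewrite /word_elt rev_cat big_cat. Qed.

Lemma word_seq1 a : word [:: a] = x a.
Proof. by rewrite /word_elt big_seq1. Qed.

Lemma qr_Jsum (T : Type) (s : seq T) (F : T -> R) :
  (forall i, J (F i)) -> J (\sum_(i <- s) F i).
Proof. by move=> JF; elim/big_rec: _ => [|i y _];
  [apply: (qr_J0 RJ) | apply: (qr_JD RJ)]. Qed.

Lemma qr_idem i : e i * e i = e i.
Proof. by rewrite (qr_orth RJ) eqxx. Qed.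

Lemma qr_nilp : exists m, forall z, J z -> z ^+ m = 0.
Proof.
have [m mP] := qr_nil RJ; exists m => z Jz.
rewrite -(mP (nseq m z)) ?size_nseq //; first by rewrite big_nseq -Monoid.iteropE.
by move=> y /nseqP[->].
Qed.

Lemma qr_unit z : J z -> exists r, r * (1 + z) = 1.
Proof.
have [m mP] := qr_nilp; move=> /mP zm.
by have [r [rz _]] := nilpotent_unit zm; exists r.
Qed.

Section Module.
Variable M : lmodType R.
Implicit Types (v w y z : M) (X : submodule M).

Lemma fixed_of_J v r : J r -> v = r *: v -> v = 0.
Proof.
have [m mP] := qr_nilp; move=> Jr E.
suff -> : v = r ^+ m *: v by rewrite (mP _ Jr) scale0r.
elim: m {mP} => [|m IH]; first by rewrite scale1r.
by rewrite exprS -scalerA -IH.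
Qed.

(** On a generator of this kind a nonzero cyclic module is local. *)
Definition homogeneous v := exists j, e j *: v = v.

Lemma homogeneous_word v s : homogeneous v -> homogeneous (word s *: v).
Proof.
move=> hv; case/lastP: s => [|s a]; first by rewrite word_nil scale1r.
by exists (tgt a); rewrite word_rcons !scalerA mulrA (qr_tgt RJ).
Qed.

Lemma homogeneous_arrow v a : homogeneous v -> homogeneous (x a *: v).
Proof. by move=> /(@homogeneous_word _ [:: a]); rewrite word_seq1. Qed.

Lemma arrow_src v j a : e j *: v = v -> x a *: v <> 0 -> src a = j.
Proof.
move=> <-; rewrite -(qr_src RJ) scalerA -mulrA (qr_orth RJ).
by case: eqP => // _; rewrite mulr0 scale0r.
Qed.

(** An element outside [J v] recovers [v], because [r e_j] is invertible on
    [e_j] unless it lies in the radical. *)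
Lemma cyclic_local v y : homogeneous v -> y \in cyclic v ->
  (exists2 r, J r & y = r *: v) \/ exists r, r *: y = v.
Proof.
move=> [j vj] /cyclicP[r ->].
case: (qr_locl RJ j r) => [Jr|[r' r'E]]; [left | right].
  by exists (r * e j); rewrite // -scalerA vj.
by exists r'; rewrite -[in LHS]vj !scalerA -mulrA r'E.
Qed.

Lemma cyclic_localX X v y : homogeneous v -> y \in cyclic v -> y \in X ->
  v \notin X -> exists2 r, J r & y = r *: v.
Proof.
by move=> hv vy yX vX; case: (cyclic_local hv vy) => // -[r E];
  rewrite -E rpredZ in vX.
Qed.

Definition Jcyclic_pred v : {pred M} :=
  [pred y | `[< exists2 r, J r & y = r *: v >]].

Fact Jcyclic_closed v : GRing.submod_closed (Jcyclic_pred v).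
Proof.
split=> [|a y z].
  by rewrite inE; apply/asboolP; exists 0; rewrite ?scale0r //; apply: (qr_J0 RJ).
rewrite !inE => /asboolP[r Jr ->] /asboolP[s Js ->]; apply/asboolP.
exists (a * r + s); last by rewrite scalerDl scalerA.
by apply: (qr_JD RJ) => //; apply: (qr_JMl RJ).
Qed.
Definition Jcyclic v := Submodule (Jcyclic_closed v).

Lemma JcyclicP v y : reflect (exists2 r, J r & y = r *: v) (y \in Jcyclic v).
Proof. by rewrite inE; apply: asboolP. Qed.

Lemma Jcyclic_cyclic v : {subset Jcyclic v <= cyclic v}.
Proof. by move=> y /JcyclicP[r _ ->]; apply/cyclicP; exists r. Qed.

Lemma Jcyclic_gen v : v <> 0 -> v \notin Jcyclic v.
Proof. by move=> v0; apply/JcyclicP => -[r Jr /(fixed_of_J Jr)]. Qed.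

Lemma Jcyclic_arrow v y a : y \in cyclic v -> x a *: y \in Jcyclic v.
Proof.
move=> /cyclicP[r ->]; apply/JcyclicP; exists (x a * r); last by rewrite scalerA.
by apply/(qr_JMr RJ)/(qr_arrow RJ).
Qed.

Lemma Jcyclic_sub v X : (forall a, x a *: v \in X) -> {subset Jcyclic v <= X}.
Proof.
move=> vX y /JcyclicP[r /(qr_genl RJ)[z ->] ->]; rewrite scaler_suml.
by apply: rpred_sum => a _; rewrite -scalerA rpredZ.
Qed.

(** [J v] is the greatest proper submodule of [R v], by locality. *)
Lemma rad_cyclic v (N : submodule M) : v <> 0 -> homogeneous v ->
  N =i cyclic v -> rad N =i Jcyclic v.
Proof.
move=> v0 hv Nv.
have vN : v \in N by rewrite Nv cyclic_id.
have Lsub (L : submodule M) : v \notin L -> {subset L <= N} ->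
    {subset L <= Jcyclic v}.
  move=> vL LN y yL; apply/JcyclicP.
  by apply: (cyclic_localX (X := L)) => //; rewrite -Nv LN.
have JN : {subset Jcyclic v <= N} by move=> y /Jcyclic_cyclic; rewrite Nv.
have Jmax : maximal_in (Jcyclic v) N.
  split=> // [/(_ v vN)|]; first exact/negP/Jcyclic_gen.
  move=> X JX XN; case: (boolP (v \in X)) => vX; [right | left] => y.
    by apply/idP/idP => [/XN //|]; rewrite Nv; apply: cyclic_sub.
  by apply/idP/idP => [|/JX //]; apply: Lsub.
move=> y; apply/idP/idP.
  by rewrite inE => /andP[_ /asboolP]; apply.
move=> yJ; rewrite inE JN //=; apply/asboolP => L [LN nLN Lmax].
have vL : v \notin L.
  by apply/negP => vL; apply: nLN => z; rewrite Nv; apply: cyclic_sub.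
case: (Lmax (Jcyclic v)) => [|//|E|E]; first exact: Lsub.
  by rewrite -E.
by have := Jcyclic_gen v0; rewrite E vN.
Qed.

(** If every word has at most one nonzero continuation on [w], then the
    products obtained by continuing as long as possible form a chain
    [w = w_0, w_1, ..., w_n = 0] with [R w_{t+1} = J w_t], so that by locality
    every submodule is one of the [R w_t]. *)
Lemma uniserial_of_unique w : w <> 0 -> homogeneous w ->
  (forall y, y \in cyclic w) ->
  (forall s b b', x b *: (word s *: w) <> 0 -> x b' *: (word s *: w) <> 0 ->
     b = b') ->
  uniserial M.
Proof.
move=> w0 hw wM wu.
pose next v := if [pick b | x b *: v != 0] is Some b then x b *: v else 0.
pose c t := iter t next w.
have cP t : c t = 0 \/ exists2 s, size s = t & c t = word s *: w.
  elim: t => [|t]; first by right; exists [::]; rewrite // word_nil scale1r.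
  rewrite /c iterS -/(c t) /next; case: pickP => [b xb|_]; last by left.
  case=> [E|[s sz E]]; first by move: xb; rewrite E scaler0 eqxx.
  by right; exists (rcons s b); rewrite ?size_rcons ?sz // word_rcons E scalerA.
have hc t : homogeneous (c t).
  case: (cP t) => [->|[s _ ->]]; last exact: homogeneous_word.
  by case: hw => j _; exists j; rewrite scaler0.
have arrow_next t a : x a *: c t \in cyclic (c t.+1).
  rewrite /c iterS -/(c t) /next; case: pickP => [b xb|/(_ a) /negbFE /eqP ->];
    last exact: rpred0.
  have [->|/eqP xa] := eqVneq (x a *: c t) 0; first exact: rpred0.
  suff -> : a = b by apply: cyclic_id.
  move: xa xb; case: (cP t) => [->|[s _ ->] xa /eqP xb]; first by rewrite scaler0.
  exact: wu xa xb.
have Jnext t : {subset Jcyclic (c t) <= cyclic (c t.+1)}.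
  exact: Jcyclic_sub.
have nextJ t : c t.+1 \in Jcyclic (c t).
  rewrite /c iterS -/(c t) /next; case: pickP => [b _|_]; last exact: rpred0.
  exact/Jcyclic_arrow/cyclic_id.
have [m mP] := qr_nil RJ.
have cm : exists t, c t == 0.
  exists m; case: (cP m) => [->//|[s sz ->]].
  rewrite /word_elt -(big_map x xpredT id) mP ?scale0r //.
    by rewrite size_map size_rev.
  by move=> z /mapP[a _ ->]; apply: (qr_arrow RJ).
case: (ex_minnP cm) => n /eqP cn n_min.
have c_neq0 t : (t < n)%N -> c t <> 0.
  by move=> tn /eqP /n_min; rewrite leqNgt tn.
have n_gt0 : (0 < n)%N by case: n cn {n_min c_neq0} => // /w0.
have cS t : {subset cyclic (c t.+1) <= cyclic (c t)}.
  exact/cyclic_sub/Jcyclic_cyclic/nextJ.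
have cNS t : (t < n)%N -> c t \notin cyclic (c t.+1).
  move=> /c_neq0 /Jcyclic_gen; apply: contra => ct.
  by apply: cyclic_sub ct; apply: nextJ.
apply: (@uniserial_of_chain _ _ n (fun i => cyclic (c (n - i)%N))) => //.
- move=> y; rewrite subn0 cn !inE; apply/asboolP/eqP => [[r ->]|->].
    by rewrite scaler0.
  by exists 0; rewrite scaler0.
- by move=> y; rewrite subnn wM.
- by move=> i iN; rewrite -(subnSK iN); apply: cS.
- move=> i iN /(_ (c (n - i.+1)%N) (cyclic_id _)); apply/negP.
  by rewrite -(subnSK iN) cNS // ltn_subrL.
move=> X.
have Xc : exists t, c t \in X by exists n; rewrite cn rpred0.
case: (ex_minnP Xc) => t tX t_min.
have tn : (t <= n)%N by apply: t_min; rewrite cn rpred0.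
exists (n - t)%N; rewrite ?leq_subr // subKn // => y.
apply/idP/idP => [yX|]; last exact: cyclic_sub.
have: forall u, (u <= t)%N -> y \in cyclic (c u).
  elim=> [|u IH] ut; first exact: wM.
  apply/Jnext/JcyclicP/(cyclic_localX (hc u) (IH (ltnW ut)) yX).
  by apply/negP => /t_min; rewrite leqNgt ut.
exact.
Qed.

End Module.

Section Projectives.
Variable M : lmodType R.
Implicit Types (v w y z : M) (X : submodule M).

Lemma uniserial_cyclic v : v <> 0 -> homogeneous v ->
  (forall s b b', x b *: (word s *: v) <> 0 -> x b' *: (word s *: v) <> 0 ->
     b = b') ->
  uniserial (sub_module (cyclic v)).
Proof.
move=> v0 [j vj] vu.
pose g : sub_module (cyclic v) := Sub v (cyclic_id v).
have valZ r (y : sub_module (cyclic v)) : \val (r *: y) = r *: \val y.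
  exact: linearZ.
have neq0 (y : sub_module (cyclic v)) : y <> 0 -> \val y <> 0.
  by move=> y0 E; apply: y0; apply: val_inj; rewrite E.
apply: (@uniserial_of_unique _ g).
- by move=> /(congr1 val); rewrite SubK.
- by exists j; apply: val_inj; rewrite valZ SubK.
- move=> y; have /cyclicP[r E] := valP y.
  by apply/cyclicP; exists r; apply: val_inj; rewrite valZ SubK.
move=> s b b' /neq0 + /neq0; rewrite !valZ SubK; exact: vu.
Qed.

(** Here [w] generates [M] and [s] is a shortest word with two nonzero
    continuations on [w]; the products [c t] of its initial segments generate
    the successive powers of the radical. *)
Section Fork.
Variables (w : M) (s : seq (arrow Q)) (b b' : arrow Q).
Hypotheses (w_gen : forall y, y \in cyclic w) (hw : homogeneous w).
Hypotheses (bb' : b <> b') (sb : x b *: (word s *: w) <> 0).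
Hypothesis sb' : x b' *: (word s *: w) <> 0.
Hypothesis short : forall s' c c', (size s' < size s)%N ->
  x c *: (word s' *: w) <> 0 -> x c' *: (word s' *: w) <> 0 -> c = c'.
Hypothesis two : forall i, (#|[pred a : arrow Q | src a == i]| <= 2)%N.

Let c t := word (take t s) *: w.

Let hc t : homogeneous (c t).
Proof. exact: homogeneous_word. Qed.

Let c_size : c (size s) = word s *: w.
Proof. by rewrite /c take_size. Qed.

Let cS t : (t < size s)%N -> c t.+1 = x (nth b s t) *: c t.
Proof. by move=> ts; rewrite /c (take_nth b) // word_rcons scalerA. Qed.

Let c_neq0 t : (t <= size s)%N -> c t <> 0.
Proof.
move=> ts E; apply: sb.
by rewrite -[in word s](cat_take_drop t s) word_cat -scalerA -/(c t) E !scaler0.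
Qed.

Let w_neq0 : w <> 0.
Proof. by move=> w0; apply: sb; rewrite w0 !scaler0. Qed.

Let Jc t : (t < size s)%N -> Jcyclic (c t) =i cyclic (c t.+1).
Proof.
move=> ts y; apply/idP/idP; last first.
  by apply: cyclic_sub; rewrite cS //; apply/Jcyclic_arrow/cyclic_id.
apply: Jcyclic_sub => a; have [->|/eqP xa] := eqVneq (x a *: c t) 0.
  exact: rpred0.
suff -> : a = nth b s t by rewrite -cS // cyclic_id.
apply: short xa _; first by rewrite size_takel // ltnW.
by rewrite -/(c t) -cS //; apply: c_neq0.
Qed.

Let radn_c t : (t <= size s)%N -> radn M t =i cyclic (c t).
Proof.
elim: t => [|t IH] ts y.
  by rewrite /c take0 word_nil scale1r w_gen.
have -> : (y \in radn M t.+1) = (y \in rad (radn M t)) by [].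
rewrite (rad_cyclic (c_neq0 (ltnW ts)) (hc t)) ?Jc //.
exact: IH (ltnW ts).
Qed.

Let radn_J : radn M (size s).+1 =i Jcyclic (word s *: w).
Proof.
rewrite -c_size; apply: (rad_cyclic (c_neq0 (leqnn _)) (hc _)).
exact: radn_c (leqnn _).
Qed.

Let fork_arrow a : x a *: (word s *: w) <> 0 -> a = b \/ a = b'.
Proof.
case: (homogeneous_word s hw) => j vj xa.
have srcj := arrow_src vj.
apply: contrapT => nab.
have := two j; rewrite leqNgt => /negP; apply.
have /card_uniqP card3 : uniq [:: a; b; b'].
  rewrite /= !inE !andbT negb_or; apply/andP; split.
    by apply/andP; split; apply/eqP => E; apply: nab; [left|right].
  exact/eqP.
apply: (@leq_trans #|[:: a; b; b']|); first by rewrite card3.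
apply/subset_leq_card/subsetP => d; rewrite !inE.
by case/or3P => /eqP ->; apply/eqP/srcj.
Qed.

Lemma fork_sum : is_sum (radn M (size s).+1)
  (cyclic (x b *: (word s *: w))) (cyclic (x b' *: (word s *: w))).
Proof.
move=> y; rewrite radn_J; split=> [/JcyclicP[r /(qr_genl RJ)[z ->] ->]|].
  exists (z b *: (x b *: (word s *: w))), (z b' *: (x b' *: (word s *: w))).
  split; [by rewrite rpredZ ?cyclic_id | by rewrite rpredZ ?cyclic_id |].
  rewrite scaler_suml (bigD1 b) //= (bigD1 b') /=; last exact/eqP/nesym.
  rewrite !scalerA addrA big1 ?addr0 // => a /andP[/eqP ab /eqP ab'].
  rewrite -!scalerA; have [->|/eqP /fork_arrow[]//] := eqVneq (x a *: (word s *: w)) 0.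
  by rewrite scaler0.
move=> [u [v [uU vV ->]]]; apply: rpredD.
  by apply: (cyclic_sub _ uU); apply/Jcyclic_arrow/cyclic_id.
by apply: (cyclic_sub _ vV); apply/Jcyclic_arrow/cyclic_id.
Qed.

(** Words longer than [s] vanish modulo this power of the radical, and the
    shorter ones continue along [s]. *)
Lemma fork_top : uniserial (quot_module (radn M (size s).+1)).
Proof.
set N := radn M _; have [j wj] := hw.
pose pi (y : M) : quot_module N := \pi_(Quotient.quot (submod_pred N)) y.
have pi0 y : y \in N -> pi y = 0.
  move=> yN; have /eqP -> : pi y == pi 0 by rewrite -Quotient.idealrBE subr0.
  exact: raddf0.
have piE y : pi y = 0 -> y \in N.
  move=> E; rewrite -[y]subr0 Quotient.idealrBE; apply/eqP.
  by rewrite -/(pi y) E; symmetry; apply: raddf0.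
have piZ r y : r *: pi y = pi (r *: y).
  apply/eqP; rewrite -Quotient.idealrBE -scalerBr rpredZ //.
  by rewrite Quotient.idealrBE reprK.
have pi_neq0 y : pi y <> 0 -> y <> 0.
  by move=> y0 E; apply: y0; rewrite E; apply: pi0; apply: rpred0.
have word_in q : word q *: w \in cyclic (c (minn (size q) (size s))).
  elim/last_ind: q => [|q a IH].
    by rewrite min0n /c take0 word_nil scale1r cyclic_id.
  rewrite word_rcons -scalerA size_rcons.
  have := Jcyclic_arrow a IH; case: (ltnP (size q) (size s)) => qs.
    by rewrite (minn_idPl qs) Jc.
  by rewrite (minn_idPr (leqW qs)); apply: Jcyclic_cyclic.
apply: (@uniserial_of_unique _ (pi w)).
- move=> /piE; rewrite radn_J => /JcyclicP[r Jr].
  rewrite scalerA => /fixed_of_J E; apply: w_neq0; apply: E.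
  exact: (qr_JMr RJ).
- by exists j; rewrite piZ wj.
- move=> u; have /cyclicP[r E] := w_gen (repr u).
  apply/cyclicP; exists r; rewrite piZ -E; symmetry; exact: reprK.
move=> q d d'.
have piZ2 a : x a *: (word q *: pi w) = pi (x a *: (word q *: w)).
  by rewrite (piZ (word q) w) (piZ (x a)).
rewrite !piZ2.
case: (ltnP (size q) (size s)) => qs.
  by move=> /pi_neq0 qd /pi_neq0; apply: short qs qd.
case; apply: pi0; rewrite radn_J -c_size; apply: Jcyclic_arrow.
by have := word_in q; rewrite (minn_idPr qs).
Qed.
End Fork.

(** Let [w] generate [M]. If some word has two nonzero continuations on [w],
    take a shortest one: the two continuing arrows are non-single, so that
    they generate uniserial submodules, with sum a power of the radical. *)
Lemma uniserial_or_quasi_biserial w :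
  (forall i, (#|[pred a : arrow Q | src a == i]| <= 2)%N) ->
  unique_words x ->
  (forall y, y \in cyclic w) -> homogeneous w -> indecomposable M ->
  uniserial M \/ quasi_biserial_module M.
Proof.
move=> two uw w_gen hw indM.
case: (pselect (uniserial M)) => [uM|nuM]; [by left | right].
pose fork s b b' :=
  [/\ b <> b', x b *: (word s *: w) <> 0 & x b' *: (word s *: w) <> 0].
pose has_fork n := `[< exists s b b', size s = n /\ fork s b b' >].
have w0 : w <> 0.
  move=> w0; case: indM => [[y /eqP y0] _]; case: y0.
  by have /cyclicP[r ->] := w_gen y; rewrite w0 scaler0.
have exF : exists n, has_fork n.
  apply: contrapT => nF; apply: nuM; apply: (uniserial_of_unique w0) => // s b b' xb xb'.
  apply: contrapT => bb'; apply: nF; exists (size s); apply/asboolP.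
  by exists s, b, b'.
case: (ex_minnP exF) => n /asboolP[s [b [b' [sz [bb' xb xb']]]]] n_min.
have short s' c c' : (size s' < size s)%N ->
    x c *: (word s' *: w) <> 0 -> x c' *: (word s' *: w) <> 0 -> c = c'.
  rewrite sz => s'n xc xc'; apply: contrapT => cc'.
  suff /n_min : has_fork (size s') by rewrite leqNgt s'n.
  by apply/asboolP; exists s', c, c'.
have [j vj] := homogeneous_word s hw.
have srcbb' : src b = src b' by rewrite !(arrow_src vj).
have nsb : non_single b.
  by apply/existsP; exists b'; rewrite srcbb' eqxx andbT; apply/eqP/nesym.
have nsb' : non_single b'.
  by apply/existsP; exists b; rewrite srcbb' eqxx andbT; apply/eqP.
have uni a : non_single a -> x a *: (word s *: w) <> 0 ->
    uniserial (sub_module (cyclic (x a *: (word s *: w)))).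
  move=> nsa xa; apply: uniserial_cyclic => //.
    exact/homogeneous_arrow/homogeneous_word.
  move=> q c c'.
  have E d : x d *: (word q *: (x a *: (word s *: w))) <> 0 ->
      x d * word (a :: q) <> 0.
    by rewrite -cat1s word_cat word_seq1 => + E; rewrite !scalerA -mulrA -mulrA mulrA
       [_ * (_ * word s)]mulrA -[x d * _ * _]mulrA E mul0r scale0r.
  have [|u _] := uw (a :: q); first by rewrite /= nsa.
  by move=> /E xc /E; apply: u.
split=> //; exists (size s).+1.
exists (cyclic (x b *: (word s *: w))), (cyclic (x b' *: (word s *: w))).
split=> //; first by split; apply: uni.
  exact: fork_sum.
exact: (fork_top w_gen hw xb short).
Qed.

(** A nonzero projective [M] is a summand of a free module. If all its
    coordinates were in [J] then [M = J M] would vanish; a coordinate outside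
    [J] is made by [e_i] into a split surjection onto [R e_i], which is an
    isomorphism when [M] is indecomposable. *)
Lemma projective_cyclic : finitely_generated M -> indecomposable M ->
  projective M -> exists2 w, homogeneous w & forall y, y \in cyclic w.
Proof.
move=> [n [g gM]] [[y0 y0N] indM] projM.
pose G (u : 'rV[R]_n) := \sum_(j < n) u 0 j *: g j.
have Glin : linear G.
  move=> a u v; rewrite /G scaler_sumr -big_split; apply: eq_bigr => j _.
  by rewrite !mxE scalerDl scalerA.
pose gl : {linear 'rV[R]_n -> M} := HB.pack G (GRing.isLinear.Build _ _ _ _ G Glin).
have [|h hE] := projM _ _ gl (idfun : {linear M -> M}).
  move=> y; have [a ->] := gM y; exists (\row_j a j).
  by apply: eq_bigr => j _; rewrite mxE.
have hsum y : y = \sum_(j < n) h y 0 j *: g j by rewrite -[LHS]hE.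
have [j [y yJ]] : exists j y, ~ J (h y 0 j).
  apply: contrapT => allJ.
  have hJ j y : J (h y 0 j).
    by apply: contrapT => nJ; apply: allJ; exists j, y.
  (* the matrix of the projection of the free module onto [M] is idempotent with
     entries in [J], hence equal to its [m]-th power, which is zero *)
  have [m mP] := qr_nil RJ.
  have prod0 k (z : seq R) y j : (size z + k = m)%N -> (forall r, r \in z -> J r) ->
      (\prod_(r <- z) r) * h y 0 j = 0.
    elim: k z y j => [|k IH] z y j; first by rewrite addn0 => sz zJ; rewrite mP // mul0r.
    move=> sz zJ; rewrite [in h y](hsum y) linear_sum summxE mulr_sumr big1 // => l _.
    rewrite linearZ mxE mulrA.
    have -> : (\prod_(r <- z) r) * h y 0 l = \prod_(r <- rcons z (h y 0 l)) r.
      by rewrite -cats1 big_cat big_seq1.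
    rewrite IH //; first by rewrite size_rcons addSnnS.
    by move=> r; rewrite mem_rcons inE => /predU1P[->|/zJ].
  case/eqP: y0N; rewrite (hsum y0) big1 // => l _.
  by have := prod0 m [::] y0 l; rewrite big_nil mul1r => ->; rewrite ?scale0r.
have [i yi] : exists i, ~ J (h y 0 j * e i).
  apply: contrapT => allJ; apply: yJ; rewrite -[_ 0 j]mulr1 -(qr_sum1 RJ) mulr_sumr.
  by apply: qr_Jsum => i; apply: contrapT => nJ; apply: allJ; exists i.
have [//|[r rE]] := qr_locl RJ i (h y 0 j).
pose psi z := h z 0 j * e i.
have psiD a z z' : psi (a *: z + z') = a * psi z + psi z'.
  by rewrite /psi linearP !mxE mulrDl mulrA.
have psiZ a z : psi (a *: z) = a * psi z.
  by rewrite /psi linearZ mxE mulrA.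
pose w := e i *: (r *: y).
have wi : e i *: w = w by rewrite /w scalerA qr_idem.
have psiw : psi w = e i by rewrite !psiZ rE qr_idem.
exists w; first by exists i.
have Kcl : GRing.submod_closed [pred z | psi z == 0].
  split=> [|a z z']; first by rewrite inE /psi linear0 mxE mul0r.
  by rewrite !inE psiD => /eqP -> /eqP ->; rewrite mulr0 addr0.
pose K := Submodule Kcl.
case: (indM (cyclic w) K).
- move=> z; split=> // _; exists (psi z *: w), (z - psi z *: w); split.
  + by rewrite rpredZ // cyclic_id.
  + rewrite inE /= -[z - _]addrC -scaleNr psiD psiw mulNr.
    by rewrite /psi -mulrA qr_idem addNr.
  + by rewrite addrC subrK.
- move=> z /cyclicP[a ->]; rewrite inE /= psiZ psiw => /eqP E.
  by rewrite -wi scalerA E scale0r.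
- move=> E; have := cyclic_id w; rewrite E inE => /eqP w0.
  case: yi; suff -> : h y 0 j * e i = 0 by apply: (qr_J0 RJ).
  have ei0 : e i = 0 by rewrite -psiw w0 /psi linear0 mxE mul0r.
  by rewrite ei0 mulr0.
move=> KE z; apply/cyclicP; exists (psi z); apply/eqP; rewrite -subr_eq0.
have : z - psi z *: w \in K; last by rewrite KE inE.
rewrite inE /= -[z - _]addrC -scaleNr psiD psiw mulNr.
by rewrite /psi -mulrA qr_idem addNr.
Qed.
End Projectives.

Lemma quiver_ring_quasi_biserial :
  (forall i, (#|[pred a : arrow Q | src a == i]| <= 2)%N) ->
  unique_words x -> projectives_quasi_biserial R.
Proof.
move=> two uw P fgP indP projP.
have [w hw w_gen] := projective_cyclic fgP indP projP.
exact: uniserial_or_quasi_biserial two uw w_gen hw indP.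
Qed.

End QuiverRing.

(** * Passing to the opposite ring *)

Definition opposite_quiver (Q : quiver) := Quiver (@tgt Q) (@src Q).

Section Opposite.
Variables (R : pzRingType) (Q : quiver) (e : vertex Q -> R) (x : arrow Q -> R).

Lemma prod_converse (T : Type) (s : seq T) (F : T -> R) :
  \prod_(i <- s) (F i : R^c) = \prod_(i <- rev s) F i.
Proof.
elim: s => [|i s IH]; first by rewrite !big_nil.
by rewrite big_cons rev_cons -cats1 big_cat big_seq1 IH.
Qed.

Lemma word_converse s :
  @word_elt R^c (opposite_quiver Q) x s = word_elt x (rev s).
Proof. exact: prod_converse. Qed.

Lemma quiver_ring_converse J : quiver_ring e x J ->
  @quiver_ring R^c (opposite_quiver Q) e x J.
Proof.
case=> sum1 orth tgtE srcE J0 JD JMl JMr Jx genl genr [m mP] locl locr comm.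
split=> //.
- by move=> i j; rewrite eq_sym; have := orth j i; case: eqP => // ->.
- exists m => s sz sJ; rewrite prod_converse; apply: mP => [|z].
    by rewrite size_rev.
  by rewrite mem_rev; apply: sJ.
- by move=> r r'; apply: comm.
Qed.

Lemma unique_words_converse : unique_words x ->
  @unique_words R^c (opposite_quiver Q) x.
Proof.
move=> uw s ns; have [|ul ur] := uw (rev s).
  rewrite has_rev; apply: sub_has ns => a /existsP[b]; rewrite /= orbC => ab.
  by apply/existsP; exists b.
by split=> b b'; rewrite word_converse; [apply: ur | apply: ul].
Qed.

End Opposite.

Lemma quiver_ring_quasi_biserial2 (R : pzRingType) (Q : quiver) e x J :
  @quiver_ring R Q e x J -> at_most_two_arrows Q -> unique_words x ->
  projectives_quasi_biserial R /\ projectives_quasi_biserial R^c.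
Proof.
move=> RJ two uw; split.
  by apply: quiver_ring_quasi_biserial RJ _ uw => i; case: (two i).
apply: (quiver_ring_quasi_biserial (quiver_ring_converse RJ)) => [i|].
  by case: (two i).
exact: unique_words_converse.
Qed.

(** * Morita equivalence of basic algebras *)

Section LinearMaps.
Variables (R : pzRingType) (M N : lmodType R).

Definition linear_map (f : M -> N) (fL : linear f) : {linear M -> N} :=
  HB.pack f (GRing.isLinear.Build _ _ _ _ f fL).

Lemma inverse_linear (f : {linear M -> N}) g : cancel f g -> cancel g f ->
  linear g.
Proof. by move=> fK gK a u v; rewrite -{1}(gK u) -{1}(gK v) -linearP fK. Qed.

Lemma null_linear : linear (fun _ : M => 0 : N).
Proof. by move=> a u v; rewrite scaler0 addr0. Qed.

Definition null_map : {linear M -> N} := linear_map null_linear.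

End LinearMaps.

Lemma right_mul_linear (R : pzRingType) (M : lmodType R) (v : M) :
  linear (fun r : R^o => (r : R) *: v).
Proof. by move=> a r s; rewrite scalerDl scalerA. Qed.

Definition right_mul (R : pzRingType) (M : lmodType R) (v : M) :
  {linear R^o -> M} := linear_map (right_mul_linear v).

Lemma regular_fg (R : pzRingType) : finitely_generated R^o.
Proof.
exists 1%N, (fun=> 1) => r; exists (fun=> r).
by rewrite big_ord1; symmetry; apply: mulr1.
Qed.

Definition regular (R : pzRingType) : fgmod R := FgMod (regular_fg R).

Lemma quotient_fg (R : pzRingType) (M : fgmod R) (N : submodule M) :
  finitely_generated (quot_module N).
Proof.
have [n [g gM]] := fgmodP M.
exists n, (fun i => \pi_(Quotient.quot (submod_pred N)) (g i)) => u.
have [a aE] := gM (repr u); exists a.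
rewrite -[u]reprK aE raddf_sum; apply: eq_bigr => i _.
apply/eqP; rewrite -Quotient.idealrBE -scalerBr rpredZ //.
by rewrite -opprB rpredN Quotient.idealrBE reprK.
Qed.

Definition quotient (R : pzRingType) (M : fgmod R) (N : submodule M) : fgmod R :=
  FgMod (quotient_fg N).

Section Projection.
Variables (R : pzRingType) (M : lmodType R) (N : submodule M).

Lemma proj_linear :
  linear (fun y : M => \pi_(Quotient.quot (submod_pred N)) y : quot_module N).
Proof.
move=> a y z; rewrite raddfD; congr (_ + _).
apply/eqP; rewrite -Quotient.idealrBE -scalerBr rpredZ //.
by rewrite -opprB rpredN Quotient.idealrBE reprK.
Qed.

Definition proj : {linear M -> quot_module N} := linear_map proj_linear.

Lemma proj_eq0 y : (proj y = 0) <-> y \in N.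
Proof.
rewrite -[y in y \in N]subr0 Quotient.idealrBE; split=> [E|/eqP E].
  by apply/eqP; apply: (etrans E); symmetry; apply: raddf0.
by apply: (etrans E); apply: raddf0.
Qed.
End Projection.

Section Functor.
Variables (k : fieldType) (A B : kalgType k) (F : lfunctor A B).

Lemma lfun_compE (L M N : fgmod A) (f : {linear L -> M}) (g : {linear M -> N})
    (h : {linear L -> N}) : (forall y, h y = g (f y)) ->
  forall y, lfun_hom F h y = lfun_hom F g (lfun_hom F f y).
Proof. exact: lfun_comp. Qed.

Lemma lfun_ext (M N : fgmod A) (f g : {linear M -> N}) :
  f =1 g -> lfun_hom F f =1 lfun_hom F g.
Proof.
move=> fg y; rewrite (lfun_compE (f := idfun) (g := g) (h := f)) //=.
by rewrite (lfun_id (l := F)).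
Qed.

Lemma lfun_add (M N : fgmod A) (f g h : {linear M -> N}) :
  (forall y, h y = f y + g y) ->
  forall y, lfun_hom F h y = lfun_hom F f y + lfun_hom F g y.
Proof.
move=> hE y; rewrite (lfun_lin (l := F) (c := 1) (f := f) (g := g)) ?rmorph1 ?scale1r //.
by move=> z; rewrite hE scale1r.
Qed.

Lemma lfun_zero (M N : fgmod A) (f : {linear M -> N}) :
  (forall y, f y = 0) -> forall y, lfun_hom F f y = 0.
Proof.
move=> f0 y; have /(_ y) : forall y, lfun_hom F f y = lfun_hom F f y + lfun_hom F f y.
  by apply: lfun_add => z; rewrite f0 addr0.
by move/(congr1 (+%R^~ (- lfun_hom F f y))); rewrite addrK subrr.
Qed.
End Functor.

Section Equivalence.
Variables (k : fieldType) (A B : kalgType k).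
Variables (F : lfunctor A B) (G : lfunctor B A).
Hypotheses (FG : natural_iso_id F G) (GF : natural_iso_id G F).

Lemma lfun_faithful (M N : fgmod A) (f g : {linear M -> N}) :
  lfun_hom F f =1 lfun_hom F g -> f =1 g.
Proof.
case: FG => eta [eta_bij eta_nat] fg y.
apply: (bij_inj (eta_bij N)).
have := eta_nat M N f y; have := eta_nat M N g y => /= -> ->.
by apply: lfun_ext => z; rewrite fg.
Qed.

Lemma lfun_neq0 (M N : fgmod A) (f : {linear M -> N}) y :
  f y <> 0 -> exists z, lfun_hom F f z <> 0.
Proof.
move=> fy; apply: contrapT => F0; apply: fy.
apply: (@lfun_faithful _ _ f (null_map M N)) => z.
rewrite [RHS]lfun_zero //; apply: contrapT => nz; apply: F0.
by exists z.
Qed.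
End Equivalence.

Section Equivalence2.
Variables (k : fieldType) (A B : kalgType k).
Variables (F : lfunctor A B) (G : lfunctor B A).
Hypotheses (FG : natural_iso_id F G) (GF : natural_iso_id G F).

Lemma lfun_full (M N : fgmod A) (h : {linear F M -> F N}) :
  exists f : {linear M -> N}, lfun_hom F f =1 h.
Proof.
case: (FG) => eta [eta_bij eta_nat].
case: (eta_bij N) => inv etaK invK.
have invL := inverse_linear etaK invK.
pose f := linear_map (linearP (linear_map invL \o lfun_hom G h \o eta M)).
exists f; apply: (lfun_faithful GF) => z.
case: (eta_bij M) => invM _ invMK.
rewrite -(invMK z); have := eta_nat M N f (invM z) => /= <-.
exact: invK.
Qed.

(** Surjections are recognized by the vanishing of their cokernel, a condition
    on morphisms only. *)
Lemma lfun_surj (M N : fgmod A) (f : {linear M -> N}) :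
  (forall y, exists z, f z = y) -> forall y, exists z, lfun_hom F f z = y.
Proof.
move=> f_surj.
have imC : GRing.submod_closed
    [pred y : F N | `[< exists z, lfun_hom F f z = y >]].
  split=> [|a u v].
    by rewrite inE; apply/asboolP; exists 0; rewrite linear0.
  rewrite !inE => /asboolP[z <-] /asboolP[t <-]; apply/asboolP.
  by exists (a *: z + t); rewrite linearP.
pose C := @quotient _ (F N) (Submodule imC).
pose g : {linear F N -> C} := proj (Submodule imC).
have gF z : g (lfun_hom F f z) = 0.
  by apply/proj_eq0; rewrite inE; apply/asboolP; exists z.
suff g0 y : g y = 0.
  by move=> y; have /proj_eq0 := g0 y; rewrite inE => /asboolP.
apply: contrapT => /(lfun_neq0 GF)[z]; apply.
case: FG => eta [eta_bij eta_nat].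
case: (eta_bij N) => inv _ invK; rewrite -(invK z).
have [t <-] := f_surj (inv z); have := eta_nat M N f t => /= ->.
rewrite -(lfun_compE (F := G) (h := null_map (F M) C)) => [|u].
  exact: lfun_zero.
by rewrite gF.
Qed.

(** Every element of [G M] is the image of [1] under a map from the regular
    module, so that map detects where [G g] does not vanish; apply [F]. *)
Lemma lfun_generator (M N : fgmod B) (g : {linear M -> N}) y : g y <> 0 ->
  exists (h : {linear F (regular A) -> M}) z, g (h z) <> 0.
Proof.
move=> /(lfun_neq0 GF)[z gz].
pose h : {linear regular A -> G M} := right_mul z.
pose gh : {linear regular A -> G N} := linear_map (linearP (lfun_hom G g \o h)).
have gh1 : gh (1 : A) <> 0 by rewrite /= scale1r.
have [t ht] := lfun_neq0 FG gh1.
case: GF => eps [eps_bij eps_nat].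
case: (eps_bij M) => inv epsK invK.
exists (linear_map (linearP (linear_map (inverse_linear epsK invK) \o lfun_hom F h))), t.
move=> /= E; apply: ht.
rewrite (lfun_compE (F := F) (f := h) (g := lfun_hom G g)) //=.
rewrite -(invK (lfun_hom F h t)); have := eps_nat M N g (inv (lfun_hom F h t)) => /= <-.
by rewrite E linear0.
Qed.
End Equivalence2.

Section Basic.
Variables (R : pzRingType) (Q : quiver).
Variables (e : vertex Q -> R) (x : arrow Q -> R) (J : R -> Prop).
Hypothesis RJ : quiver_ring e x J.

(** Modulo the nilpotent ideal [J] the ring is commutative, so the idempotent
    [1 - c * d] lies in [J] and vanishes. *)
Lemma dedekind_finite (c d : R) : d * c = 1 -> c * d = 1.
Proof.
move=> dc; apply/eqP; rewrite eq_sym -subr_eq0; apply/eqP.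
have Jp : J (1 - c * d) by rewrite -dc; apply: (qr_comm RJ).
apply: (@fixed_of_J _ _ _ _ _ RJ R^o _ _ Jp).
change (1 - c * d = (1 - c * d) * (1 - c * d)).
by rewrite mulrBr mulr1 mulrBl mul1r -mulrA (mulrA d) dc mul1r subrr subr0.
Qed.

(** A generator maps onto each local module [R e_i]; as these have pairwise
    non-isomorphic tops, the sum of such maps is still onto modulo [J], hence
    onto. *)
Lemma generator_onto_regular (P : lmodType R) :
  (forall (M N : fgmod R) (g : {linear M -> N}) y, g y <> 0 ->
     exists (h : {linear P -> M}) z, g (h z) <> 0) ->
  exists h : {linear P -> R^o}, forall r, exists z, h z = r.
Proof.
move=> genP.
have comp i : exists hz : {linear P -> R^o} * P, (hz.1 hz.2 : R) * e i = e i.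
  case: (pselect (J (e i))) => [Ji|nJ].
    exists (null_map P R^o, 0); rewrite mul0r.
    symmetry; apply: (@fixed_of_J _ _ _ _ _ RJ R^o _ _ Ji).
    by symmetry; apply: (qr_idem RJ).
  have NC : GRing.submod_closed [pred r : R^o | `[< J ((r : R) * e i) >]].
    split=> [|a r s].
      by rewrite inE; apply/asboolP; rewrite mul0r; apply: (qr_J0 RJ).
    rewrite !inE => /asboolP Jr /asboolP Js; apply/asboolP.
    rewrite mulrDl -mulrA; apply: (qr_JD RJ) => //.
    exact: (qr_JMl RJ).
  pose C := @quotient _ (regular R) (Submodule NC).
  pose g : {linear regular R -> C} := proj (Submodule NC).
  have [|h [z hz]] := genP (regular R) C g (1 : R).
    by move=> /proj_eq0; rewrite inE => /asboolP; rewrite mul1r.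
  have nJh : ~ J ((h z : R) * e i).
    by move=> Jh; apply: hz; apply/proj_eq0; rewrite inE; apply/asboolP.
  case: (qr_locl RJ i (h z)) => // -[r rE].
  by exists (h, r *: z); rewrite /= linearZ -mulrA.
have [hz hzE] := choice comp.
(* the factor [e i] on the right makes the off-diagonal terms fall into [J] *)
pose f (z : P) : R^o := \sum_i ((hz i).1 z : R) * e i.
have fL : linear f.
  move=> a z t; rewrite /f scaler_sumr -big_split; apply: eq_bigr => i _ /=.
  by rewrite linearP mulrDl -mulrA.
exists (linear_map fL) => r.
have Jf i : J (f (e i *: (hz i).2) - e i).
  rewrite /f (bigD1 i) //= linearZ -mulrA hzE (qr_idem RJ) addrC addrK.
  elim/big_rec: _ => [|j y ji Jy]; first exact: (qr_J0 RJ).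
  apply: (qr_JD RJ) => //; rewrite linearZ -mulrA.
  have := qr_comm RJ (e i) (((hz j).1 (hz i).2 : R) * e j).
  by rewrite -[in X in _ - X]mulrA (qr_orth RJ) (negbTE ji) mulr0 subr0.
pose z := \sum_i e i *: (hz i).2.
have Jz : J (f z - 1).
  have -> : f z - 1 = \sum_i (f (e i *: (hz i).2) - e i).
    rewrite sumrB (qr_sum1 RJ); congr (_ - 1).
    exact: (linear_sum (linear_map fL)).
  exact: (qr_Jsum RJ).
have [s sE] := qr_unit RJ Jz.
exists ((r * s) *: z).
rewrite linearZ /=; change (r * s * f z = r).
by rewrite -[f z](subrK 1) [_ + 1]addrC -mulrA sE mulr1.
Qed.
End Basic.

Section MoritaBasic.
Variables (k : fieldType) (A B : kalgType k).
Variables (QA : quiver) (eA : vertex QA -> A) (xA : arrow QA -> A) (JA : A -> Prop).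
Variables (QB : quiver) (eB : vertex QB -> B) (xB : arrow QB -> B) (JB : B -> Prop).
Hypothesis AJ : quiver_ring eA xA JA.
Hypothesis BJ : quiver_ring eB xB JB.

(** Both [F A] maps onto [B] and [B ~ F (G B)] maps onto [F A], so that
    Dedekind-finiteness makes the surjection [B -> F A] an isomorphism. *)
Lemma morita_regular (F : lfunctor A B) (G : lfunctor B A) :
  natural_iso_id F G -> natural_iso_id G F ->
  exists u : {linear B^o -> F (regular A)}, bijective u.
Proof.
move=> FG GF.
have [v v_surj] := generator_onto_regular BJ (@lfun_generator _ _ _ _ _ FG GF).
have [g g_surj] := generator_onto_regular AJ (@lfun_generator _ _ _ _ _ GF FG).
have Fg_surj := @lfun_surj _ _ _ _ _ FG GF (G (regular B)) (regular A) g g_surj.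
case: (GF) => eps [eps_bij _].
pose u : {linear B^o -> F (regular A)} :=
  linear_map (linearP (lfun_hom F (g : {linear G (regular B) -> regular A})
                       \o eps (regular B))).
have u_surj y : exists r, u r = y.
  have [t <-] := Fg_surj y; case: (eps_bij (regular B)) => inv _ invK.
  by exists (inv t); rewrite /= invK.
have uE r : v (u r) = r * v (u 1) :> B.
  have {1}-> : r = (r : B) *: (1 : B^o) by symmetry; apply: mulr1.
  by rewrite !linearZ.
have [d dE] : exists d, d * v (u 1) = 1 :> B.
  have [t tE] := v_surj 1; have [d dE] := u_surj t.
  by exists d; rewrite -uE dE.
have cd := dedekind_finite BJ dE.
have uK r s : u r = u s -> r = s.
  move=> E; rewrite -[r](mulr1 (r : B)) -[s](mulr1 (s : B)) -cd.
  by change (r * (v (u 1) * d) = s * (v (u 1) * d) :> B); rewrite !mulrA -!uE E.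
have [inv invK] := choice u_surj.
by exists u, inv => // r; apply: uK; rewrite invK.
Qed.

(** Basic algebras that are Morita equivalent are isomorphic: the rings are the
    opposites of the endomorphism rings of their regular modules, which
    correspond to each other. *)
Lemma morita_basic_iso : morita_equivalent A B ->
  exists theta : {rmorphism A -> B}, bijective theta.
Proof.
move=> [F [G [FG GF]]].
have [u [uinv uK uinvK]] := morita_regular FG GF.
pose rho (a : A) : {linear regular A -> regular A} := @right_mul A A^o a.
pose theta (a : A) : B := uinv (lfun_hom F (rho a) (u 1)).
have uE r : u r = (r : B) *: u 1 by rewrite -linearZ; congr (u _); symmetry; apply: mulr1.
have thetaE a : lfun_hom F (rho a) (u 1) = u (theta a) by rewrite uinvK.
have thetaD : zmod_morphism theta.
  move=> a b; apply: (can_inj uK); rewrite linearB -!thetaE.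
  rewrite (lfun_add (F := F) (f := rho (a - b)) (g := rho b) (h := rho a)) ?addrK //.
  by move=> r /=; rewrite scalerBr subrK.
have theta1 : monoid_morphism theta.
  split.
    apply: (can_inj uK); rewrite -thetaE (lfun_id (l := F)) //.
    by move=> r /=; apply: mulr1.
  move=> a b; apply: (can_inj uK); rewrite -thetaE.
  rewrite (lfun_compE (F := F) (f := rho a) (g := rho b)); last first.
    by move=> r /=; apply: mulrA.
  rewrite thetaE uE linearZZ thetaE.
  by rewrite -linearZZ.
pose th : {rmorphism A -> B} := HB.pack theta
  (GRing.isZmodMorphism.Build _ _ theta thetaD)
  (GRing.isMonoidMorphism.Build _ _ theta theta1).
have th_inj : injective theta.
  move=> a b E.
  have rE : rho a =1 rho b.
    apply: (lfun_faithful FG) => y; rewrite -(uinvK y) uE !linearZ.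
    by rewrite !thetaE E.
  by have := rE (1 : A); rewrite /= !scale1r.
have th_surj b : exists a, theta a = b.
  pose h : {linear F (regular A) -> F (regular A)} :=
    linear_map (linearP (u \o @right_mul B B^o b
                           \o linear_map (inverse_linear uK uinvK))).
  have [f fE] := lfun_full FG GF h.
  exists (f (1 : A)); apply: (can_inj uK); rewrite -thetaE.
  have -> : u b = h (u 1) by rewrite /= uK scale1r.
  rewrite -fE; apply: lfun_ext => r /=.
  rewrite -linearZ; congr (f _); exact: mulr1.
have [inv invK] := choice th_surj.
by exists th, inv => // a; apply: th_inj; rewrite invK.
Qed.
End MoritaBasic.

(** * Path algebras and their admissible quotients *)

Lemma mem_ideal_gen (R : pzRingType) (S : R -> Prop) y : S y -> y \in ideal_gen S.
Proof. by move=> Sy; apply/asboolP => J SJ; apply: SJ. Qed.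

Lemma ideal_gen_sub (R : pzRingType) (S : R -> Prop) (J : ideal R) :
  (forall y, S y -> y \in J) -> {subset ideal_gen S <= J}.
Proof. by move=> SJ y /asboolP; apply. Qed.

Lemma prod_ideal_pow (R : pzRingType) (J : ideal R) (s : seq R) :
  (forall z, z \in s -> z \in J) -> \prod_(z <- s) z \in ideal_pow J (size s).
Proof.
elim: s => [|y s IH] sJ; first exact: mem_ideal_gen.
rewrite big_cons; apply: mem_ideal_gen; exists y, (\prod_(z <- s) z).
split=> //; first by apply: sJ; rewrite mem_head.
by apply: IH => z zs; apply: sJ; rewrite inE zs orbT.
Qed.

Lemma central_mulACA (R : pzRingType) (a b f g : R) :
  (forall y, b * y = y * b) -> (a * f) * (b * g) = (b * a) * (f * g).
Proof.
by move=> bC; rewrite -mulrA (mulrA f) -(bC f) -(mulrA b) (mulrA a) -(bC a).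
Qed.

Section PathAlgebra.
Variables (k : fieldType) (Q : quiver).
Local Notation kQ := (path_alg k Q).
Local Notation pe := (@path_elt k Q : qpath Q -> kQ).
Local Notation ar := (@arrow_elt k Q : arrow Q -> kQ).
Local Notation ev i := (path_elt k (trivial_path i) : kQ).
Local Notation cst := (kalg_in kQ).
Local Notation word := (word_elt ar).

Lemma scale_cst (c : k) (f : path_ring k Q) : c *: f = cst c * (f : kQ) :> kQ.
Proof.
change (c *: f = pa_mul (c *: pa_one k Q) f).
by rewrite -pa_scalerAl pa_mul1r.
Qed.

Lemma path_span (f : kQ) :
  f = \sum_(p <- msupp (f : path_ring k Q)) cst ((f : path_ring k Q)@_p) * pe p.
Proof.
rewrite [LHS](monalgE (f : {malg k[qpath Q]})); apply: eq_bigr => p _.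
rewrite -scale_cst path_elt.unlock; apply/malgP => q.
have E (c : k) : (mkmalgU p c)@_q = c *+ (p == q) by exact: mcoeffU.
have H (c : k) (b : bool) : c *+ b = c * (1 *+ b) by rewrite mulrnAr mulr1.
rewrite [RHS]mcoeffZ.
exact: (etrans (E _) (etrans (H _ _) (congr1 ( *%R _) (esym (E 1))))).
Qed.

Lemma path_ind (P : kQ -> Prop) : P 0 ->
  (forall f g, P f -> P g -> P (f + g)) ->
  (forall c p, P (cst c * pe p)) -> forall f, P f.
Proof.
move=> P0 PD Pp f; rewrite (path_span f).
by elim/big_rec: _ => [//|p g _ Pg]; apply: PD.
Qed.

Lemma pe_mul p q : pe p * pe q = path_prod k p q.
Proof. exact: pa_mulE. Qed.

Lemma pe_mul_some p q : psrc p = ptgt q ->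
  exists2 r, pe p * pe q = pe r & qpath_val r = (psrc q, parrows q ++ parrows p).
Proof.
move=> pq; have [r rE rV] := pcomp_some pq; exists r => //.
by rewrite pe_mul /path_prod rE.
Qed.

Lemma pe_mul_none p q : psrc p <> ptgt q -> pe p * pe q = 0.
Proof. by move=> pq; rewrite pe_mul /path_prod pcomp_none. Qed.

Lemma ev_mul i p : ev i * pe p = if ptgt p == i then pe p else 0.
Proof. by rewrite pe_mul /path_prod pcomp_trivl; case: eqP. Qed.

Lemma mul_ev i p : pe p * ev i = if psrc p == i then pe p else 0.
Proof. by rewrite pe_mul /path_prod pcomp_trivr; case: eqP. Qed.

Lemma ev_orth i j : ev i * ev j = if j == i then ev i else 0.
Proof.
by rewrite ev_mul (_ : ptgt (trivial_path j) = j) //; case: eqP => // ->.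
Qed.

Lemma cst_mulCA c f g : f * (cst c * g) = cst c * (f * g).
Proof. by rewrite mulrA -kalg_central mulrA. Qed.

Lemma cst_mulACA c d f g : (cst c * f) * (cst d * g) = cst (d * c) * (f * g).
Proof. by rewrite rmorphM; apply/central_mulACA/kalg_central. Qed.

Lemma word_ev s i :
  word s * ev i = oapp (path_elt k) 0 (insub (i, s) : option (qpath Q)).
Proof.
elim/last_ind: s => [|s a IH].
  rewrite word_nil mul1r; case: insubP => //= p _ pE.
  by congr (path_elt k _); apply: val_inj; rewrite /= pE.
rewrite word_rcons -mulrA IH.
case: insubP => [p _ pE|/= nc]; last first.
  rewrite mulr0; case: insubP => //= p; rewrite -cats1 composable_cat.
  by rewrite (negbTE nc).
have pV : psrc p = i /\ parrows p = s by rewrite /psrc /parrows pE.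
have [/eqP ap|/eqP ap] := eqVneq (src a) (ptgt p).
  have /pe_mul_some[r -> rV] : psrc (arrow_path a) = ptgt p by apply/eqP.
  have rE : val r = (i, rcons s a) by rewrite /= rV pV.1 pV.2 -cats1.
  by rewrite -rE valK.
rewrite pe_mul_none //; case: insubP => //= q.
rewrite -cats1 composable_cat /= andbT => /andP[_ /eqP E] _.
by case: ap; rewrite E /ptgt pV.1 pV.2.
Qed.

Lemma pe_word p : pe p = word (parrows p) * ev (psrc p).
Proof.
rewrite word_ev.
have <- : val p = (psrc p, parrows p) by case: (p) => -[].
by rewrite valK.
Qed.

Lemma ar_src a : ar a * ev (src a) = ar a.
Proof. by rewrite mul_ev eqxx. Qed.

Lemma ar_tgt a : ev (tgt a) * ar a = ar a.
Proof. by rewrite ev_mul eqxx. Qed.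

Lemma pe_first p a s : parrows p = a :: s -> pe p = word s * ar a.
Proof.
move=> pE; rewrite pe_word pE -cat1s word_cat word_seq1 -mulrA.
have /= := valP p; rewrite -/(parrows p) pE /= => /andP[/eqP ap _].
by rewrite /psrc -ap ar_src.
Qed.

Lemma pe_last p a s : parrows p = rcons s a ->
  pe p = ar a * (word s * ev (psrc p)).
Proof. by move=> pE; rewrite pe_word pE word_rcons mulrA. Qed.

Lemma ar_pe a p : ar a * pe p = 0 \/
  exists r b s, parrows r = b :: s /\ ar a * pe p = pe r.
Proof.
have [ap|/eqP ap] := eqVneq (src a) (ptgt p); last by left; apply: pe_mul_none.
right; have [r rE rV] := @pe_mul_some (arrow_path a) p ap.
have : parrows r = rcons (parrows p) a by rewrite /parrows rV -cats1.
by case: (parrows p) => [|b s] pE; exists r; [exists a, [::] | exists b, (rcons s a)].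
Qed.

Lemma pe_ar a p : pe p * ar a = 0 \/
  exists r b s, parrows r = rcons s b /\ pe p * ar a = pe r.
Proof.
have [ap|/eqP ap] := eqVneq (psrc p) (tgt a); last by left; apply: pe_mul_none.
right; have [r rE rV] := @pe_mul_some p (arrow_path a) ap.
have : parrows r = a :: parrows p by rewrite /parrows rV.
by case/lastP: (parrows p) => [|s b] pE; exists r; [exists a, [::] | exists b, (a :: s)].
Qed.

Local Notation J := (arrow_ideal k Q).

Lemma ar_ideal a : ar a \in J.
Proof. by apply: mem_ideal_gen; exists a. Qed.

Lemma arrow_ideal_ind (L : kQ -> Prop) :
  (forall u v, L u -> L v -> L (u + v)) ->
  (forall r u, L u -> L (r * u)) -> (forall r u, L u -> L (u * r)) ->
  L 0 -> (forall a, L (ar a)) -> forall z, z \in J -> L z.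
Proof.
move=> LD LMl LMr L0 Lar.
have Lz : zmod_closed [pred z | `[< L z >]].
  split=> [|u v]; rewrite !inE; first exact/asboolP.
  move=> /asboolP Lu /asboolP Lv; apply/asboolP; apply: LD => //.
  by rewrite -mulN1r; apply: LMl.
have LMl' a u : u \in [pred z | `[< L z >]] -> a * u \in [pred z | `[< L z >]].
  by rewrite !inE => /asboolP Lu; apply/asboolP/LMl.
have LMr' a u : u \in [pred z | `[< L z >]] -> u * a \in [pred z | `[< L z >]].
  by rewrite !inE => /asboolP Lu; apply/asboolP/LMr.
move=> z zJ; suff : z \in Ideal Lz LMl' LMr' by rewrite inE => /asboolP.
by apply: (ideal_gen_sub _ zJ) => y [a ->]; rewrite inE; apply/asboolP.
Qed.

(** The left ideal generated by the arrows is two-sided, hence is the arrow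
    ideal: multiplying an arrow on the right by a path gives zero or a path of
    positive length, which has a first arrow. *)
Lemma arrow_ideal_left z : z \in J -> exists y, z = \sum_a y a * ar a.
Proof.
pose L z := exists y, z = \sum_a y a * ar a.
have L0 : L 0 by exists (fun=> 0); rewrite big1 // => a _; rewrite mul0r.
have LD u v : L u -> L v -> L (u + v).
  move=> [y ->] [y' ->]; exists (fun a => y a + y' a); rewrite -big_split.
  by apply: eq_bigr => a _; rewrite mulrDl.
have LMl r u : L u -> L (r * u).
  move=> [y ->]; exists (fun a => r * y a); rewrite mulr_sumr.
  by apply: eq_bigr => a _; rewrite mulrA.
have Lar a : L (ar a).
  exists (fun b => if b == a then 1 else 0); rewrite (bigD1 a) //= eqxx mul1r.
  by rewrite big1 ?addr0 // => b /negbTE ->; rewrite mul0r.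
have Larf a f : L (ar a * f).
  elim/path_ind: f => [|f g Lf Lg|c p]; rewrite ?mulr0 ?mulrDr //; first exact: LD.
  rewrite mulrA -kalg_central -mulrA; apply: (LMl).
  by case: (ar_pe a p) => [-> //|[r [b [s [rE ->]]]]]; rewrite (pe_first rE); apply: LMl.
apply: (arrow_ideal_ind LD LMl _ L0 Lar) => r _ [y ->].
rewrite mulr_suml; elim/big_rec: _ => // a v _ Lv.
by apply: LD => //; rewrite -mulrA; apply: LMl.
Qed.

Lemma arrow_ideal_right z : z \in J -> exists y, z = \sum_a ar a * y a.
Proof.
pose L z := exists y, z = \sum_a ar a * y a.
have L0 : L 0 by exists (fun=> 0); rewrite big1 // => a _; rewrite mulr0.
have LD u v : L u -> L v -> L (u + v).
  move=> [y ->] [y' ->]; exists (fun a => y a + y' a); rewrite -big_split.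
  by apply: eq_bigr => a _; rewrite mulrDr.
have LMr r u : L u -> L (u * r).
  move=> [y ->]; exists (fun a => y a * r); rewrite mulr_suml.
  by apply: eq_bigr => a _; rewrite mulrA.
have Lar a : L (ar a).
  exists (fun b => if b == a then 1 else 0); rewrite (bigD1 a) //= eqxx mulr1.
  by rewrite big1 ?addr0 // => b /negbTE ->; rewrite mulr0.
have Lfar a f : L (f * ar a).
  elim/path_ind: f => [|f g Lf Lg|c p]; rewrite ?mul0r ?mulrDl //; first exact: LD.
  rewrite -mulrA kalg_central; apply: (LMr).
  by case: (pe_ar a p) => [-> //|[r [b [s [rE ->]]]]]; rewrite (pe_last rE); apply: LMr.
apply: (arrow_ideal_ind LD _ LMr L0 Lar) => r _ [y ->].
rewrite mulr_sumr; elim/big_rec: _ => // a v _ Lv.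
by apply: LD => //; rewrite mulrA; apply: LMr.
Qed.

Lemma pe_pow m p : (m <= size (parrows p))%N -> pe p \in ideal_pow J m.
Proof.
move=> mp; rewrite pe_word -[parrows p](cat_take_drop m) word_cat.
apply/idealMr/idealMl; rewrite -{2}(size_takel mp).
rewrite /word_elt -(big_map ar xpredT id) -size_rev -(size_map ar).
by apply: prod_ideal_pow => z /mapP[a _ ->]; apply: ar_ideal.
Qed.

(** Paths of positive length lie in the arrow ideal, so only the coefficients of
    the trivial paths matter. *)
Lemma diag_part f : exists (c : vertex Q -> k), f - \sum_i cst (c i) * ev i \in J.
Proof.
elim/path_ind: f => [|f g [c cJ] [d dJ]|c p].
- exists (fun=> 0); rewrite big1 ?subrr ?rpred0 // => i _.
  by rewrite rmorph0 mul0r.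
- exists (fun i => c i + d i).
  have -> : \sum_i cst (c i + d i) * ev i
      = \sum_i cst (c i) * ev i + \sum_i cst (d i) * ev i.
    by rewrite -big_split; apply: eq_bigr => i _; rewrite rmorphD mulrDl.
  rewrite opprD addrACA; exact: (rpredD cJ dJ).
case E: (parrows p) => [|a s].
  exists (fun i => if i == psrc p then c else 0).
  have -> : \sum_i cst (if i == psrc p then c else 0) * ev i = cst c * ev (psrc p).
    rewrite (bigD1 (psrc p)) //= eqxx big1 ?addr0 // => i /negbTE ->.
    by rewrite rmorph0 mul0r.
  by rewrite (pe_word p) E word_nil mul1r subrr rpred0.
exists (fun=> 0); have -> : \sum_i cst 0 * ev i = 0.
  by rewrite big1 // => i _; rewrite rmorph0 mul0r.
by rewrite subr0 (pe_first E) mulrA; exact: (idealMl _ (ar_ideal a)).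
Qed.

End PathAlgebra.

(** Modulo an ideal containing [f - u] and [g - v], the elements [f] and [g]
    commute because [u] and [v] do. *)
Lemma commutator_mod (R : pzRingType) (f g u v : R) : u * v = v * u ->
  f * g - g * f = ((f - u) * g + u * (g - v)) - ((g - v) * f + v * (f - u)).
Proof.
move=> uv; rewrite 2!mulrBl 2!mulrBr addrA subrK addrA subrK uv.
by rewrite opprB addrA subrK.
Qed.

(** As [d f e = (1 + d z) e], a left inverse of [1 + d z] recovers [e] from
    [f e]. *)
Lemma local_unit (R : pzRingType) (f e c d z s : R) :
  e * e = e -> d * c = 1 -> f * e = c * e + z -> s * (1 + d * z) = 1 ->
  exists r, r * (f * e) = e.
Proof.
move=> ee dc fe sz; exists (s * d); rewrite -mulrA.
have -> : d * (f * e) = (1 + d * z) * e.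
  rewrite -{1}ee (mulrA f) fe mulrDl -mulrA ee mulrDr !mulrA dc.
  by rewrite -mulrDl.
by rewrite mulrA sz mul1r.
Qed.

Section Presentation.
Variables (k : fieldType) (Q : quiver) (I : ideal (path_alg k Q)).
Variables (R : pzRingType) (pi : {rmorphism path_alg k Q -> R}).
Hypotheses (pi_surj : forall r, exists f, pi f = r).
Hypotheses (pi_ker : forall f, pi f = 0 <-> f \in I).
Local Notation kQ := (path_alg k Q).
Local Notation pe := (@path_elt k Q : qpath Q -> kQ).
Local Notation ar := (@arrow_elt k Q : arrow Q -> kQ).
Local Notation ev i := (path_elt k (trivial_path i) : kQ).
Local Notation cst := (kalg_in kQ).
Local Notation J := (arrow_ideal k Q).

Definition pres_idem (i : vertex Q) : R := pi (ev i).
Definition pres_arrow (a : arrow Q) : R := pi (ar a).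
Definition pres_rad (r : R) : Prop := exists2 f, f \in J & r = pi f.

Let vertex_part f i : exists c,
  f * ev i - cst c * ev i \in J /\ ev i * f - cst c * ev i \in J.
Proof.
have [c cJ] := diag_part f; exists (c i).
have El : (\sum_j cst (c j) * ev j) * ev i = cst (c i) * ev i.
  rewrite mulr_suml (eq_bigr (fun j => if j == i then cst (c i) * ev i else 0)).
    by rewrite -big_mkcond big_pred1_eq.
  by move=> j _; rewrite -mulrA ev_orth eq_sym; case: eqP => [->|]; rewrite ?mulr0.
have Er : ev i * (\sum_j cst (c j) * ev j) = cst (c i) * ev i.
  rewrite mulr_sumr (eq_bigr (fun j => if j == i then cst (c i) * ev i else 0)).
    by rewrite -big_mkcond big_pred1_eq.
  by move=> j _; rewrite cst_mulCA ev_orth; case: eqP => [->|]; rewrite ?mulr0.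
by split; [rewrite -El -mulrBl; apply: idealMr | rewrite -Er -mulrBr; apply: idealMl].
Qed.

Hypothesis adm : admissible I.

Let nilp : exists m, forall s : seq R, size s = m ->
  (forall z, z \in s -> pres_rad z) -> \prod_(z <- s) z = 0.
Proof.
case: adm => m _ [Jm _]; exists m => s sz sJ.
have [t [tJ tE]] : exists t : seq kQ, (forall f, f \in t -> f \in J) /\ s = map pi t.
  elim: s sJ {sz} => [|y s IH] sJ; first by exists [::].
  have [f fJ fE] := sJ y (mem_head _ _).
  have [z zs|t [tJ tE]] := IH; first by apply: sJ; rewrite inE zs orbT.
  exists (f :: t); rewrite /= -fE -tE; split=> // g.
  by rewrite inE => /predU1P[-> //|/tJ].
rewrite tE big_map -rmorph_prod; apply/pi_ker/Jm.
by rewrite -sz tE size_map; apply: prod_ideal_pow.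
Qed.

(** For the two local conditions write [f e_i = c e_i + z] with [c] in [k] and [z]
    in the arrow ideal: if [c] is nonzero then [c + z] is invertible.  The ring
    [R] is only isomorphic to [k Q / I], so that presentations can be carried
    along isomorphisms. *)
Lemma presentation_quiver_ring : quiver_ring pres_idem pres_arrow pres_rad.
Proof.
have unitJ z : pres_rad z -> exists r, r * (1 + z) = 1 /\ (1 + z) * r = 1.
  case: nilp => m mP zJ; apply: (@nilpotent_unit _ _ m).
  rewrite -(mP (nseq m z)) ?size_nseq //; first by rewrite big_nseq -Monoid.iteropE.
  by move=> y /nseqP[->].
have idemR i : pres_idem i * pres_idem i = pres_idem i.
  by rewrite -rmorphM ev_orth eqxx.
have cstV c : c != 0 -> pi (cst c^-1) * pi (cst c) = 1.
  by move=> c0; rewrite -!rmorphM mulVf // !rmorph1.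
have cstV' c : c != 0 -> pi (cst c) * pi (cst c^-1) = 1.
  by move=> c0; rewrite -!rmorphM divff // !rmorph1.
split.
- by rewrite -rmorph_sum -[RHS](rmorph1 pi).
- move=> i j; rewrite /pres_idem -rmorphM ev_mul /ptgt /= eq_sym.
  by case: eqP => [->|_]; rewrite ?rmorph0.
- by move=> a; rewrite /pres_arrow -rmorphM ar_tgt.
- by move=> a; rewrite /pres_arrow -rmorphM ar_src.
- by exists 0; rewrite ?rpred0 ?rmorph0.
- by move=> _ _ [f fJ ->] [g gJ ->]; exists (f + g); rewrite ?rpredD ?rmorphD.
- move=> r _ [f fJ ->]; have [g <-] := pi_surj r.
  by exists (g * f); rewrite ?rmorphM //; apply: idealMl.
- move=> r _ [f fJ ->]; have [g <-] := pi_surj r.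
  by exists (f * g); rewrite ?rmorphM //; apply: idealMr.
- by move=> a; exists (ar a) => //; apply: ar_ideal.
- move=> _ [f /arrow_ideal_left[y ->] ->]; exists (pi \o y).
  by rewrite rmorph_sum; apply: eq_bigr => a _; rewrite rmorphM.
- move=> _ [f /arrow_ideal_right[y ->] ->]; exists (pi \o y).
  by rewrite rmorph_sum; apply: eq_bigr => a _; rewrite rmorphM.
- exact: nilp.
- move=> i r; have [f <-] := pi_surj r; have [c [cJ _]] := vertex_part f i.
  set z := f * ev i - _ in cJ.
  have fE : f * ev i = cst c * ev i + z by rewrite addrC subrK.
  have [c0|c0] := eqVneq c 0.
    by left; exists z => //; rewrite -rmorphM fE c0 rmorph0 mul0r add0r.
  right; have [|s [sE _]] := unitJ (pi (cst c^-1) * pi z).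
    by rewrite -rmorphM; exists (cst c^-1 * z) => //; apply: idealMl.
  apply: (@local_unit _ (pi f) _ _ _ (pi z) _ (idemR i) (cstV _ c0) _ sE).
  by rewrite -!rmorphM fE rmorphD.
- move=> i r; have [f <-] := pi_surj r; have [c [_ cJ]] := vertex_part f i.
  set z := ev i * f - _ in cJ.
  have fE : ev i * f = ev i * cst c + z by rewrite addrC -kalg_central subrK.
  have [c0|c0] := eqVneq c 0.
    by left; exists z => //; rewrite -rmorphM fE c0 rmorph0 mulr0 add0r.
  right; have [|s [_ sE]] := unitJ (pi z * pi (cst c^-1)).
    by rewrite -rmorphM; exists (z * cst c^-1) => //; apply: idealMr.
  apply: (@local_unit R^c (pi f) _ _ _ (pi z) _ (idemR i) (cstV' _ c0) _ sE).
  by change (pi (ev i) * pi f = pi (ev i) * pi (cst c) + pi z);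
     rewrite -!rmorphM fE rmorphD.
- move=> r r'; have [f <-] := pi_surj r; have [g <-] := pi_surj r'.
  exists (f * g - g * f); last by rewrite rmorphB !rmorphM.
  have [c cJ] := diag_part f; have [d dJ] := diag_part g.
  set u := \sum_i _ in cJ; set v := \sum_i _ in dJ.
  have diagM (c1 c2 : vertex Q -> k) :
      (\sum_i cst (c1 i) * ev i) * (\sum_i cst (c2 i) * ev i)
      = \sum_i cst (c1 i * c2 i) * ev i.
    rewrite mulr_suml; apply: eq_bigr => i _; rewrite mulr_sumr.
    rewrite (eq_bigr (fun j => if j == i then cst (c1 i * c2 i) * ev i else 0)).
      by rewrite -big_mkcond big_pred1_eq.
    move=> j _; rewrite cst_mulACA ev_orth.
    case: eqP => [->|_]; last by rewrite mulr0.
    exact: (congr1 (fun a => cst a * ev i) (mulrC _ _)).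
  have uv : u * v = v * u.
    apply: etrans (diagM c d) _; apply: etrans (esym (diagM d c)).
    apply: eq_bigr => i _; exact: (congr1 (fun a => cst a * ev i) (mulrC _ _)).
  rewrite (commutator_mod f g uv).
  have JD f1 f2 g1 g2 : f1 \in J -> f2 \in J -> f1 * g1 + g2 * f2 \in J.
    by move=> J1 J2; apply: rpredD; [apply: idealMr | apply: idealMl].
  exact: (rpredB (JD _ _ _ _ cJ dJ) (JD _ _ _ _ dJ cJ)).
Qed.

Lemma presentation_unique_words : unique_continuation I -> unique_words pres_arrow.
Proof.
move=> uc s ns.
have wordE q : word_elt pres_arrow q = pi (word_elt ar q).
  by rewrite /word_elt rmorph_prod.
have pathE : word_elt ar s <> 0 -> exists2 p, parrows p = s & word_elt ar s = pe p.
  case: s ns => // a s _; rewrite -cat1s word_cat word_seq1 -ar_src mulrA.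
  rewrite -(word_seq1 ar a) -word_cat cat1s word_ev.
  by case: insubP => //= p _ pE _; exists p; rewrite // /parrows pE.
have nI f : pi f <> 0 <-> f \notin I.
  by split=> [f0|/negP f0 E]; [apply/negP => /pi_ker | apply: f0; apply/pi_ker].
have [s0|/eqP /pathE[p ps pE]] := eqVneq (word_elt ar s) 0.
  by split=> b b'; rewrite wordE s0 rmorph0 ?mulr0 ?mul0r.
have [|ul ur] := uc p; first by rewrite ps.
split=> b b'; rewrite wordE pE -!rmorphM => /nI pb /nI; [exact: ul | exact: ur].
Qed.
End Presentation.

(** * Admissible quotients are quasi-biserial *)

Section Quotient.
Variables (k : fieldType) (Q : quiver) (I : ideal (path_alg k Q)).

Lemma quot_pi_ker f : quot_pi I f = 0 <-> f \in I.
Proof.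
rewrite -[f in f \in I]subr0 Quotient.idealrBE; split=> [E|/eqP E].
  by apply/eqP; apply: (etrans E); symmetry; apply: raddf0.
by apply: (etrans E); apply: raddf0.
Qed.

Lemma quot_pi_onto r : exists f, quot_pi I f = r.
Proof. by exists (repr r); apply: quot_pi_surj. Qed.

Lemma finitely_many_paths m : exists s : seq (qpath Q),
  forall p, (size (parrows p) < m)%N -> p \in s.
Proof.
pose T : finType := (vertex Q * {n : 'I_m & n.-tuple (arrow Q)})%type.
pose path_of (z : T) : option (qpath Q) := insub (z.1, val (tagged z.2)).
exists (pmap path_of (enum T)) => p pm; rewrite mem_pmap; apply/mapP.
pose t : (Ordinal pm).-tuple (arrow Q) := in_tuple (parrows p).
exists (psrc p, Tagged (fun n : 'I_m => n.-tuple (arrow Q)) t).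
  by rewrite mem_enum.
rewrite /path_of /=.
have -> : (psrc p, parrows p) = val p by case: (p) => -[].
by rewrite valK.
Qed.

Lemma quot_alg_finite_dimensional : admissible I ->
  finite_dimensional (quot_alg I).
Proof.
move=> [m _ [Jm _]]; have [s sP] := finitely_many_paths m.
exists (size s), (fun i => quot_pi I (path_elt k (tnth (in_tuple s) i))).
move=> r; have [f <-] := quot_pi_onto r.
elim/path_ind: f => [|f g [c cE] [d dE]|c p].
- exists (fun=> 0); rewrite rmorph0 big1 // => i _.
  by rewrite rmorph0 mul0r.
- exists (fun i => c i + d i); apply: etrans (rmorphD _ f g) _.
  apply: etrans (congr2 +%R cE dE) _; rewrite -big_split.
  by apply: eq_bigr => i _; rewrite rmorphD mulrDl.
case: (ltnP (size (parrows p)) m) => pm.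
  have /tnthP[i pE] : p \in in_tuple s by apply: sP.
  exists (fun j => if j == i then c else 0).
  rewrite (bigD1 i) //= eqxx big1 ?addr0 => [|j /negbTE ->]; last first.
    by rewrite !rmorph0 mul0r.
  by rewrite rmorphM -pE.
exists (fun=> 0); rewrite big1 => [|i _]; last by rewrite !rmorph0 mul0r.
by apply/quot_pi_ker/idealMl/Jm/pe_pow.
Qed.
End Quotient.

Theorem theorem2p8 (k : fieldType) (Q : quiver) (I : ideal (path_alg k Q))
    (hI : admissible I) :
  special_quasi_biserial (quot_alg I) -> quasi_biserial_algebra (quot_alg I).
Proof.
move=> [Q' [I' [adm' two uc [F [G [FG GF]]]]]].
have QI := presentation_quiver_ring (@quot_pi_onto _ _ I) (@quot_pi_ker _ _ I) hI.
have QI' := presentation_quiver_ring (@quot_pi_onto _ _ I') (@quot_pi_ker _ _ I') adm'.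
(* the equivalence is used backwards, to present [k Q / I] by [Q'] and [I'] *)
have [|theta [theta' thetaK theta'K]] :=
  morita_basic_iso (A := quot_alg I') (B := quot_alg I) QI' QI.
  by exists G, F.
pose pi : {rmorphism path_alg k Q' -> quot_alg I} := theta \o quot_pi I'.
have pi_onto r : exists f, pi f = r.
  have [f fE] := quot_pi_onto (theta' r); exists f.
  by rewrite /= fE theta'K.
have pi_ker f : pi f = 0 <-> f \in I'.
  rewrite -quot_pi_ker; split=> [E|/= ->]; last exact: rmorph0.
  by apply: (can_inj thetaK); rewrite rmorph0.
have [left right] := quiver_ring_quasi_biserial2
  (presentation_quiver_ring pi_onto pi_ker adm') two
  (presentation_unique_words pi_ker uc).
by split=> //; apply: quot_alg_finite_dimensional.
Qed.
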